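(* Let $\alpha$ be a Pisot number with $\alpha<\frac{\sqrt5+1}{2}$. Then $L(\alpha)\ge\frac{3}{17}$.
   Context: A Pisot number is a real algebraic integer $\alpha>1$ all of whose other conjugates lie strictly inside the unit disc. For real $x$, $\|x\|$ denotes the distance from $x$ to the nearest integer. For a Pisot number $\alpha$, $L(\alpha):=\sup_{\xi\in\mathbb R}\liminf_{n\to\infty}\|\xi\alpha^n\|$. *)

(* Defs.v *)
From mathcomp Require Import all_boot all_order all_algebra.
From mathcomp Require Import complex.
From mathcomp Require Import all_classical all_reals all_analysis.

Set Implicit Arguments.
Unset Strict Implicit.
Unset Printing Implicit Defensive.

Import Order.TTheory GRing.Theory Num.Theory numFieldNormedType.Exports.
Local Open Scope classical_set_scope.
Local Open Scope ring_scope.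

(* An irreducible polynomial of Q[X] vanishing at z is a scalar multiple of the
   minimal polynomial of z over Q. *)
Definition conjugates (R : realType) (z w : R[i]) : Prop :=
  exists p : {poly rat},
    [/\ irreducible_poly p, root (map_poly ratr p) z
      & root (map_poly ratr p) w].

Definition algebraic_integer (R : realType) (x : R) : Prop :=
  integralOver (intr : int -> R) x.

Definition pisot (R : realType) (alpha : R) : Prop :=
  [/\ algebraic_integer alpha, 1 < alpha
    & forall w : R[i], conjugates (alpha%:C)%C w -> w != (alpha%:C)%C ->
        `|w| < 1].

Definition dist_int (R : realType) (x : R) : R :=
  inf [set `|x - m%:~R| | m in [set: int]].

(* The real-valued limn_inf and sup (which have default values on unbounded
   arguments) are the genuine ones here, since 0 <= dist_int x <= 1/2. *)
Definition L (R : realType) (alpha : R) : R :=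
  sup [set limn_inf (fun n : nat => dist_int (xi * alpha ^+ n))
      | xi in [set: R]].

(* Main.v *)
(* Let P be the minimal polynomial of alpha, d its degree, Q = X^d P(1/X) and
   U = P(0) P / Q, a power series with integer coefficients and U(0) = 1. It has
   modulus 1 on the unit circle, and 1/alpha is its only pole in the unit disc;
   all the factors of P/Q but (X - alpha) / (1 - alpha X) are Blaschke factors,
   that is, causal contractions. Hence, for all h and n,
     sum_(j <= n) (h U)_j^2 <=
       sum_(j <= n) h_j^2 + (alpha^2 - 1) (sum_(j <= n) alpha^(n - j) h_j)^2.
   Let B = 1 - X - X^2. Suitable h = g B show that, when alpha is less than the
   golden ratio, the first coefficient at which B U differs from 1 (from 1 - X^2
   if B U = 1 - X^2 + O(X^3)) is -1, and restrict the next one. Then some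
   polynomial h turns the inequality into an equality, so that h U is a
   polynomial too; it is minus the reversal of h, and P is the reversal of h.
   This yields, in the spirit of Dufresnoy and Pisot, that either P is
   X^n (X^2 - X - 1) + X^2 - 1 or X^6 - 2 X^5 + X^4 - X^2 + X - 1, or |P(1)| >= 3,
   or |P(-1)| >= 3.
   In each case there are integers q, z, c such that q divides P(z) and all the
   residues of c z^k modulo q lie in [3q/17, 14q/17]. The sequence -c z^k/q
   satisfies modulo 1 the recurrence of P, hence is congruent modulo 1 to
   xi alpha^k plus a combination of powers of the other conjugates of alpha, which
   tends to 0. *)
Require Import Defs.
From mathcomp Require Import all_boot all_order all_algebra complex.
From mathcomp Require Import all_classical all_reals all_analysis.
From mathcomp Require Import ring lra zify.

Set Implicit Arguments.
Unset Strict Implicit.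
Unset Printing Implicit Defensive.

Import Order.TTheory GRing.Theory Num.Theory numFieldNormedType.Exports.
Local Open Scope ring_scope.

Definition eqmodX (A : nzRingType) (n : nat) (p q : {poly A}) :=
  forall j, (j < n)%N -> p`_j = q`_j.

Definition energy (F : numDomainType) (n : nat) (p : {poly F}) : F :=
  \sum_(j < n) `|p`_j| ^+ 2.

(** For p of degree at most d this is X^d p(1/X); keeping d as a parameter makes the reversal
    additive in p. *)
Definition revp (A : nzRingType) (d : nat) (p : {poly A}) : {poly A} :=
  \poly_(i < d.+1) p`_(d - i).

(** * Causal contractivity of Blaschke products *)

Section Truncation.
Variable A : comNzRingType.
Implicit Types p q r : {poly A}.

Lemma eqmodX_sym n p q : eqmodX n p q -> eqmodX n q p.
Proof. by move=> pq j jn; rewrite pq. Qed.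

Lemma eqmodX_trans n q p r : eqmodX n p q -> eqmodX n q r -> eqmodX n p r.
Proof. by move=> pq qr j jn; rewrite pq ?qr. Qed.

Lemma eqmodX_le m n p q : (m <= n)%N -> eqmodX n p q -> eqmodX m p q.
Proof. by move=> mn pq j jm; apply: pq; apply: leq_trans mn. Qed.

Lemma eqmodX_mull n r p q : eqmodX n p q -> eqmodX n (r * p) (r * q).
Proof.
move=> pq j jn; rewrite !coefM; apply: eq_bigr => i _.
by rewrite pq //; lia.
Qed.

Lemma eqmodX_mulr n r p q : eqmodX n p q -> eqmodX n (p * r) (q * r).
Proof. by move=> pq; rewrite ![_ * r]mulrC; apply: eqmodX_mull. Qed.

Lemma eqmodX_cancel n r p q :
  r`_0 = 1 -> eqmodX n (r * p) (r * q) -> eqmodX n p q.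
Proof.
move=> r0 rpq j; elim/ltn_ind: j => j IH jn.
have := rpq j jn; rewrite !coefM !big_ord_recl subn0 r0 !mul1r.
move=> /eqP; rewrite (eq_bigr (fun i : 'I_j => r`_(lift ord0 i) * q`_(j - lift ord0 i))).
  by rewrite (inj_eq (addIr _)) => /eqP.
by move=> i _; rewrite IH // /lift /= /bump /=; have := ltn_ord i; lia.
Qed.

Lemma revp_XsubCM d w p : (size p <= d.+1)%N ->
  revp d.+1 (('X - w%:P) * p) = (1 - w%:P * 'X) * revp d p.
Proof.
move=> sp; apply/polyP => i; rewrite coef_poly !mulrBl !coefB mul1r.
rewrite !coefXM -mulrA !coefCM coefXM !coef_poly.
have [->|i0] := eqVneq i 0%N.
  by rewrite !subn0 /= mulr0 subr0 [p`_d.+1]nth_default // mulr0 subr0.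
case: ltnP => id2; last first.
  have -> : (i < d.+1)%N = false by lia.
  have -> : (i.-1 < d.+1)%N = false by lia.
  by rewrite mulr0 subr0.
have -> : (i.-1 < d.+1)%N by lia.
have -> : (d - i.-1 = d.+1 - i)%N by lia.
case: ltnP => id1.
  have -> : (d.+1 - i == 0)%N = false by lia.
  by have -> : ((d.+1 - i).-1 = d - i)%N by lia.
by have -> : (d.+1 - i = 0)%N by lia.
Qed.

Lemma revp_prod (ws : seq A) :
  revp (size ws) (\prod_(w <- ws) ('X - w%:P)) = \prod_(w <- ws) (1 - w%:P * 'X).
Proof.
elim: ws => [|w ws IH].
  by rewrite !big_nil; apply/polyP => -[|i]; rewrite coef_poly ?coef1.
rewrite !big_cons /= revp_XsubCM ?IH //.
by rewrite size_prod_XsubC.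
Qed.

End Truncation.

Lemma map_revp (A B : nzRingType) (f : {rmorphism A -> B}) d p :
  map_poly f (revp d p) = revp d (map_poly f p).
Proof.
apply/polyP => i; rewrite coef_map /revp coef_poly [RHS]coef_poly.
by case: ifP => _; [rewrite coef_map | rewrite raddf0].
Qed.

Section Blaschke.
Variable C : numClosedFieldType.
Implicit Types t k y : {poly C}.

Lemma eq_energy (F : numDomainType) n (p q : {poly F}) :
  eqmodX n p q -> energy n p = energy n q.
Proof. by move=> pq; apply: eq_bigr => i _; rewrite pq. Qed.

(* With the state w_(j+1) = b^* w_j + k_j the output of one Blaschke factor is
   t_j = (1 - |b|^2) w_j - b k_j, and
   |k_j|^2 - |t_j|^2 = (1 - |b|^2) (|w_(j+1)|^2 - |w_j|^2) telescopes. *)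
Lemma blaschke_factor_contractive (b : C) n t k : `|b| < 1 ->
  eqmodX n ((1 - (b^*)%:P * 'X) * t) (('X - b%:P) * k) ->
  energy n t <= energy n k.
Proof.
move=> b1 tk.
pose w := fix w j : C := if j is j'.+1 then b^* * w j' + k`_j' else 0.
have tE j : (j < n)%N -> t`_j = (1 - b * b^*) * w j - b * k`_j.
  elim: j => [|j IH] jn; have := tk _ jn.
    rewrite !mulrBl !coefB !mul1r -!mulrA !coefCM !coefXM /= !mulr0 subr0 => ->.
    by rewrite subr0.
  rewrite !mulrBl !coefB !mul1r -!mulrA !coefCM !coefXM /= => tkj.
  have -> : t`_j.+1 = k`_j - b * k`_j.+1 + b^* * t`_j by rewrite -tkj; ring.
  rewrite IH; [|by lia].
  by ring.
have key j : (j <= n)%N -> energy j k - energy j t = (1 - b * b^*) * (w j * (w j)^*).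
  elim: j => [|j IH] jn.
    by rewrite /energy !big_ord0 /= mul0r mulr0 subr0.
  have IHj := IH (ltnW jn).
  rewrite /energy !big_ord_recr /= -![\sum_(i < j) _]/(energy j _).
  rewrite opprD addrACA IHj !normCK tE //.
  by rewrite !(rmorphB, rmorphD, rmorphM, rmorph1) /= !conjCK; ring.
rewrite -subr_ge0 key // mulr_ge0 ?mul_conjC_ge0 //.
by rewrite -normCK subr_ge0 expr_le1 // ltW.
Qed.

(** One factor at a time: t is the output of the first factor fed with k, and the remaining factors
    turn t into y. *)
Lemma blaschke_contractive (bs : seq C) n y k :
  (forall b, b \in bs -> `|b| < 1) ->
  eqmodX n (\prod_(b <- bs) (1 - (b^*)%:P * 'X) * y)
           (\prod_(b <- bs) ('X - b%:P) * k) ->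
  energy n y <= energy n k.
Proof.
elim: bs k => [|b bs IH] k bs1 yk.
  by move: yk; rewrite !big_nil !mul1r => yk; rewrite (eq_energy yk).
(* The truncated geometric series inverts 1 - b^* X modulo X^n. *)
pose S : {poly C} := \sum_(i < n) ((b^*)%:P * 'X) ^+ i.
pose t := S * (('X - b%:P) * k).
have tk : eqmodX n ((1 - (b^*)%:P * 'X) * t) (('X - b%:P) * k).
  move=> j jn; rewrite /t mulrA.
  have -> : (1 - (b^*)%:P * 'X) * S = 1 - ((b^*) ^+ n)%:P * 'X^n.
    by rewrite -opprB mulNr -subrX1 opprB exprMn -polyC_exp.
  by rewrite mulrBl mul1r coefB -mulrA coefCM coefXnM jn mulr0 subr0.
apply: le_trans (blaschke_factor_contractive (bs1 b (mem_head _ _)) tk).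
apply: IH => [c cbs|]; first by apply: bs1; rewrite in_cons cbs orbT.
apply: (@eqmodX_cancel _ _ (1 - (b^*)%:P * 'X)).
  by rewrite coefB coef1 coefCM coefX mulr0 subr0.
move: yk; rewrite !big_cons => yk.
rewrite mulrA; apply: eqmodX_trans yk _.
rewrite -mulrA mulrCA [X in eqmodX _ _ X]mulrCA.
by apply: eqmodX_mull; apply: eqmodX_sym.
Qed.

End Blaschke.

(** * The energy inequality with one pole in the unit disc *)

(** This is the coefficient of X^n in the series h / (1 - a X), whose pole lies in the unit disc
    when a > 1. *)
Definition tailval (A : nzRingType) (a : A) (n : nat) (h : {poly A}) : A :=
  \sum_(j < n.+1) a ^+ (n - j) * h`_j.

Lemma tailvalS (A : comNzRingType) (a : A) n (h : {poly A}) :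
  tailval a n.+1 h = a * tailval a n h + h`_n.+1.
Proof.
rewrite /tailval big_ord_recr /= subnn expr0 mul1r; congr (_ + _).
rewrite mulr_sumr; apply: eq_bigr => i _.
by rewrite subSn ?exprS ?mulrA //; have := ltn_ord i; lia.
Qed.

Lemma tailval0 (A : comNzRingType) (a : A) (h : {poly A}) : tailval a 0 h = h`_0.
Proof. by rewrite /tailval big_ord_recl big_ord0 /= mul1r addr0. Qed.

Lemma energyS (R : realDomainType) n (p : {poly R}) :
  energy n.+1 p = energy n p + p`_n ^+ 2.
Proof. by rewrite /energy big_ord_recr /= real_normK ?num_real. Qed.

Lemma energy_map_complex (R : rcfType) n (p : {poly R}) :
  energy n (map_poly (real_complex R) p) = (energy n p)%:C%C.
Proof.
rewrite /energy rmorph_sum; apply: eq_bigr => i _ /=.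
by rewrite coef_map /= rmorphXn /= normc_def /= expr0n addr0 sqrtr_sqr.
Qed.

Section EnergyInequality.
Variables (R : rcfType) (alpha eta : R) (d N : nat) (P1 U : {poly R}).
Hypotheses (monicP1 : P1 \is monic) (sizeP1 : size P1 = d.+1).
Hypothesis rootsP1 : forall w : R[i],
  root (map_poly (real_complex R) P1) w -> `|w| < 1.
Hypothesis eta2 : eta ^+ 2 = 1.
Hypothesis QU : eqmodX N (revp d.+1 (('X - alpha%:P) * P1) * U)
                         (eta *: (('X - alpha%:P) * P1)).

Local Notation toC := (real_complex R).

Lemma blaschke_real n (y k : {poly R}) :
  eqmodX n (revp d P1 * y) (P1 * k) -> energy n y <= energy n k.
Proof.
move=> yk; have [bs def_P1] := closed_field_poly_normal (map_poly toC P1).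
move: def_P1; rewrite lead_coef_map (monicP monicP1) scale1r => def_P1.
have sz_bs : size bs = d.
  by have := size_prod_XsubC bs id; rewrite -def_P1 size_map_poly sizeP1 => -[].
have revE : \prod_(b <- bs) (1 - (b^*%C)%:P * 'X) = map_poly toC (revp d P1).
  (* [P1] has real coefficients, so its reversal is its own conjugate, in which each root b appears
     as b^*. *)
  have -> : map_poly toC (revp d P1) =
            map_poly (fun z : R[i] => z^*%C) (map_poly toC (revp d P1)).
    by apply/polyP => i; rewrite !coef_map /= oppr0.
  rewrite map_revp def_P1 -sz_bs revp_prod rmorph_prod.
  apply: eq_bigr => b _.
  by rewrite rmorphB rmorph1 rmorphM /= map_polyC map_polyX.
rewrite -lecR -!energy_map_complex.
apply: (@blaschke_contractive _ bs) => [b bbs|].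
  by apply: rootsP1; rewrite def_P1 root_prod_XsubC.
rewrite -def_P1 [X in eqmodX _ (X * _) _]revE -!rmorphM /=.
by move=> j jn; rewrite !coef_map yk.
Qed.

(** Write h = (1 - alpha X) k modulo X^(n+1). The factor 1 - alpha X cancels against the reversal of
    P, so h U is the Blaschke product over the roots of [P1] applied to eta (X - alpha) k. The
    energies of (X - alpha) k and of h differ by the telescoping sum of (alpha^2 - 1) (k_j^2 -
    k_(j-1)^2), and k_n is [tailval alpha n h]. *)
Lemma energy_ineq n (h : {poly R}) : (n < N)%N ->
  energy n.+1 (h * U) <=
  energy n.+1 h + (alpha ^+ 2 - 1) * tailval alpha n h ^+ 2.
Proof.
move=> nN; pose k := \poly_(i < n.+1) tailval alpha i h.
have kE i : (i < n.+1)%N -> k`_i = tailval alpha i h by move=> ?; rewrite coef_poly ifT.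
have hk : eqmodX n.+1 ((1 - alpha%:P * 'X) * k) h.
  move=> -[|j] jn; rewrite mulrBl mul1r coefB -mulrA coefCM coefXM /= kE //.
    by rewrite mulr0 subr0 tailval0.
  by rewrite kE ?(ltnW jn) // tailvalS addrC addKr.
have lhs : energy n.+1 (h * U) = energy n.+1 ((1 - alpha%:P * 'X) * k * U).
  by apply/esym/eq_energy/eqmodX_mulr.
have -> : energy n.+1 h + (alpha ^+ 2 - 1) * tailval alpha n h ^+ 2 =
          energy n.+1 (('X - alpha%:P) * k).
  have {}kE m : (m <= n)%N ->
      energy m.+1 h + (alpha ^+ 2 - 1) * tailval alpha m h ^+ 2 =
      energy m.+1 (('X - alpha%:P) * k).
    elim: m => [|m IH] mn.
      rewrite !energyS /energy !big_ord0 [('X - _) * k]mulrBl coefB coefXM coefCM kE //.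
      rewrite tailval0 ?coefXM ?coefCM /= ?kE //. by rewrite ?tailval0; ring.
    rewrite energyS [RHS]energyS -IH ?(ltnW mn) // [('X - _) * k]mulrBl coefB coefXM coefCM /=.
    by rewrite !kE ?ltnS ?(ltnW mn) // tailvalS; ring.
  exact: kE.
have -> : energy n.+1 (('X - alpha%:P) * k) = energy n.+1 (eta *: (('X - alpha%:P) * k)).
  rewrite /energy; apply: eq_bigr => i _.
  by rewrite coefZ normrM exprMn -[`|eta| ^+ 2]normrX eta2 normr1 mul1r.
rewrite lhs; apply: blaschke_real => j jn.
have := @eqmodX_mull _ N k _ _ QU j (leq_trans jn nN).
rewrite revp_XsubCM ?sizeP1 //.
have -> : k * ((1 - alpha%:P * 'X) * revp d P1 * U) =
          revp d P1 * ((1 - alpha%:P * 'X) * k * U) by ring.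
move=> ->; congr (_`_ _).
have E : k * (('X - alpha%:P) * P1) = P1 * (('X - alpha%:P) * k) by ring.
by rewrite -!scalerAr E.
Qed.

End EnergyInequality.

(** * Testing the energy inequality *)

(** The reversal of X^2 - X - 1, whose larger root is the golden ratio. *)
Definition fibden (A : nzRingType) : {poly A} := 1 - 'X - 'X^2.

(** The coefficients of [fibden] times the generating series of g. *)
Definition fibdiff (A : nzRingType) (g : nat -> A) (j : nat) : A :=
  match j with
  | 0 => g 0%N
  | 1 => g 1%N - g 0%N
  | i.+2 => g i.+2 - g i.+1 - g i
  end.

Definition sqsum (R : nzRingType) (n : nat) (f : nat -> R) : R :=
  \sum_(j < n) f j ^+ 2.

Lemma sqsumS (R : nzRingType) n (f : nat -> R) :
  sqsum n.+1 f = sqsum n f + f n ^+ 2.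
Proof. by rewrite /sqsum big_ord_recr. Qed.

Lemma sqsum0 (R : nzRingType) (f : nat -> R) : sqsum 0 f = 0.
Proof. by rewrite /sqsum big_ord0. Qed.

Lemma eq_sqsum (R : nzRingType) n (f g : nat -> R) :
  (forall j, (j < n)%N -> f j = g j) -> sqsum n f = sqsum n g.
Proof. by move=> fg; apply: eq_bigr => i _; rewrite fg. Qed.

Lemma sqsum_const (R : comNzRingType) n k a (f : nat -> R) :
  (forall j, (n <= j < n + k)%N -> f j = a) ->
  sqsum (n + k) f = sqsum n f + k%:R * a ^+ 2.
Proof.
elim: k => [|k IH] fa; first by rewrite addn0 mul0r addr0.
rewrite addnS sqsumS IH => [|j jk]; last by apply: fa; lia.
by rewrite fa; [rewrite -[k.+1]addn1 natrD; ring | lia].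
Qed.

Lemma sqsum_alt (R : comNzRingType) n k a b (f : nat -> R) :
  (forall i, (i < k)%N -> f (n + i.*2)%N = a) ->
  (forall i, (i < k)%N -> f (n + i.*2).+1 = b) ->
  sqsum (n + k.*2) f = sqsum n f + k%:R * (a ^+ 2 + b ^+ 2).
Proof.
elim: k => [|k IH] fa fb; first by rewrite addn0 mul0r addr0.
rewrite doubleS !addnS !sqsumS IH => [|i ik|i ik]; [|apply: fa; lia|apply: fb; lia].
rewrite fa ?fb //.
by rewrite -[k.+1]addn1 natrD; ring.
Qed.

Section Energy.
Variables (R : realFieldType) (alpha : R) (N : nat) (U : {poly R}).
Hypothesis U0 : U`_0 = 1.
Hypothesis energyP : forall n (h : {poly R}), (n < N)%N ->
  energy n.+1 (h * U) <=
  energy n.+1 h + (alpha ^+ 2 - 1) * tailval alpha n h ^+ 2.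

Lemma energy_sqsum n (p : {poly R}) : energy n p = sqsum n (fun j => p`_j).
Proof. by apply: eq_bigr => i _; rewrite real_normK ?num_real. Qed.

Lemma coef_addXn_low n (p : {poly R}) (t : R) j : (j < n)%N ->
  (p + t *: 'X^n)`_j = p`_j.
Proof. by move=> jn; rewrite coefD coefZ coefXn ltn_eqF // mulr0 addr0. Qed.

Lemma coef_addXn n (p : {poly R}) (t : R) : (p + t *: 'X^n)`_n = p`_n + t.
Proof. by rewrite coefD coefZ coefXn eqxx mulr1. Qed.

Lemma tailval_addXn n (p : {poly R}) (t : R) :
  tailval alpha n (p + t *: 'X^n) = tailval alpha n p + t.
Proof.
case: n => [|n]; first by rewrite !tailval0 coef_addXn.
rewrite !tailvalS coef_addXn addrA; congr (_ + _ + _); congr (_ * _).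
by rewrite /tailval; apply: eq_bigr => i _; rewrite coef_addXn_low.
Qed.

Lemma mulU_addXn_low n (p : {poly R}) (t : R) j : (j < n)%N ->
  ((p + t *: 'X^n) * U)`_j = (p * U)`_j.
Proof.
by move=> jn; rewrite mulrDl coefD -scalerAl coefZ coefXnM jn mulr0 addr0.
Qed.

Lemma mulU_addXn n (p : {poly R}) (t : R) :
  ((p + t *: 'X^n) * U)`_n = (p * U)`_n + t.
Proof.
by rewrite mulrDl coefD -scalerAl coefZ coefXnM ltnn subnn U0 mulr1.
Qed.

(** The test polynomial is h + t X^n. As U(0) = 1, the parameter t enters only the top coefficient
    of h, that of h U, and the tail value. *)
Lemma energy_top n (h : {poly R}) (t : R) : (n < N)%N ->
  energy n (h * U) + ((h * U)`_n + t) ^+ 2 <=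
  energy n h + (h`_n + t) ^+ 2 + (alpha ^+ 2 - 1) * (tailval alpha n h + t) ^+ 2.
Proof.
move=> nN; have := energyP (h + t *: 'X^n) nN.
rewrite !energyS mulU_addXn coef_addXn tailval_addXn.
rewrite (@eq_energy _ n (_ * U) (h * U)); last by move=> j jn; rewrite mulU_addXn_low.
by rewrite (@eq_energy _ n (h + _) h) // => j jn; rewrite coef_addXn_low.
Qed.

Lemma tailval_large n m (h : {poly R}) : (size h <= n.+1)%N -> (n <= m)%N ->
  tailval alpha n h = 0 -> tailval alpha m h = 0.
Proof.
move=> sh + h0; elim: m => [|m IH] nm; first by move: h0; rewrite (_ : n = 0)%N //; lia.
have [<- //|nm1] := eqVneq n m.+1.
rewrite tailvalS IH; last lia.
by rewrite mulr0 add0r nth_default // (leq_trans sh) //; lia.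
Qed.

Lemma energy_le m n (p : {poly R}) : (m <= n)%N -> energy m p <= energy n p.
Proof.
move=> /subnK <-; elim: (n - m)%N => [//|k IH].
by rewrite addSn energyS (le_trans IH) // lerDl sqr_ge0.
Qed.

Lemma energy_size m n (p : {poly R}) : (size p <= m)%N -> (m <= n)%N ->
  energy n p = energy m p.
Proof.
move=> sp /subnK <-; elim: (n - m)%N => [//|k IH].
rewrite addSn energyS IH nth_default ?expr0n ?addr0 //.
by rewrite (leq_trans sp) ?leq_addl.
Qed.

(* A vector without slack transports all its energy to the first n + 1
   coefficients of its image, hence its image is a polynomial. *)
Lemma energy_null n (h p : {poly R}) : (n < N)%N ->
  (size h <= n.+1)%N -> (size p <= n.+1)%N -> tailval alpha n h = 0 ->
  eqmodX n.+1 (h * U) p -> energy n.+1 p = energy n.+1 h ->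
  eqmodX N (h * U) p.
Proof.
move=> nN sh sp h0 hp ep j jN.
have [jn|nj] := ltnP j n.+1; first exact: hp.
rewrite [RHS]nth_default; last exact: leq_trans sp nj.
have := energyP h jN.
rewrite (tailval_large sh (ltnW nj) h0) expr0n mulr0 addr0 energyS.
rewrite (energy_size sh (leqW nj)).
rewrite -ep -(eq_energy hp) -lerBrDl => le0.
apply/eqP; rewrite -sqrf_eq0 eq_le sqr_ge0 andbT (le_trans le0) // subr_le0.
exact: energy_le.
Qed.

Section Pattern.
Variables (A : {poly R}) (n : nat) (g : nat -> R).
Hypotheses (nN : (n < N)%N) (BU : eqmodX n.+1 (fibden R * U) A).

Let G := \poly_(i < n.+1) g i.
Let w j := (G * A)`_j.

Lemma coef_fibdenM j : (j <= n)%N -> (fibden R * G)`_j = fibdiff g j.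
Proof.
move=> jn; rewrite /fibden !mulrBl !coefB mul1r coefXM coefXnM.
case: j jn => [|[|j]] jn /=; rewrite !coef_poly ?subr0 ?subSS ?subn0 ?ifT //; lia.
Qed.

Lemma fibdenMU j : (j <= n)%N -> (fibden R * G * U)`_j = w j.
Proof. by move=> jn; rewrite mulrAC mulrC; exact: (@eqmodX_mull _ _ G _ _ BU). Qed.

(** The test polynomial is [fibden] times G, plus t X^n; its image under U is known up to X^n,
    because [fibden] times U agrees with A there. *)
Lemma pattern_top t :
  sqsum n w + (w n + t) ^+ 2 <= sqsum n (fibdiff g) + (fibdiff g n + t) ^+ 2
    + (alpha ^+ 2 - 1) * (\sum_(j < n.+1) alpha ^+ (n - j) * fibdiff g j + t) ^+ 2.
Proof.
have := energy_top (fibden R * G) t nN.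
rewrite !energy_sqsum fibdenMU // coef_fibdenM //.
rewrite (@eq_sqsum _ n _ w); last by move=> j /ltnW jn; exact: fibdenMU.
rewrite (@eq_sqsum _ n (fun j => (_ * G)`_j) (fibdiff g)); last first.
  by move=> j /ltnW jn; exact: coef_fibdenM.
congr (_ <= _ + _ * (_ + _) ^+ 2); apply: eq_bigr => i _.
by rewrite coef_fibdenM // -ltnS.
Qed.

(** Taking t to cancel the tail value removes alpha, and the two top squares then agree. *)
Lemma pattern_balanced : w n = fibdiff g n -> sqsum n w <= sqsum n (fibdiff g).
Proof.
move=> wn; have := pattern_top (- \sum_(j < n.+1) alpha ^+ (n - j) * fibdiff g j).
by rewrite wn subrr expr0n mulr0 addr0 lerD2r.
Qed.

End Pattern.

End Energy.

(** * Bounds on the first coefficients of B U beyond a known pattern *)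

(** The constant lies between the golden ratio and 31/19, below which (5/2)(7/2 - alpha) exceeds 1 +
    (9/4) alpha; the final estimate of [first_coef_lt] rests on this. *)
Lemma golden_ub (R : realFieldType) (alpha : R) :
  1 < alpha -> alpha ^+ 2 < alpha + 1 -> alpha < 163 / 100.
Proof. by move=> a1 a2; nra. Qed.

Section Exclusion.
Variables (R : realFieldType) (alpha : R) (N : nat) (U : {poly R}).
Hypotheses (alpha_gt1 : 1 < alpha) (alpha_lt : alpha ^+ 2 < alpha + 1).
Hypothesis U0 : U`_0 = 1.
Hypothesis energyP : forall n (h : {poly R}), (n < N)%N ->
  energy n.+1 (h * U) <=
  energy n.+1 h + (alpha ^+ 2 - 1) * tailval alpha n h ^+ 2.

Lemma coef_patternM (g : nat -> R) n m (c e : R) j : (j <= n)%N ->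
  ((\poly_(i < n.+1) g i) * (1 + c%:P * 'X^m + e%:P * 'X^(m.+1)) : {poly R})`_j =
  g j + (if (j < m)%N then 0 else c * g (j - m)%N)
      + (if (j < m.+1)%N then 0 else e * g (j - m.+1)%N).
Proof.
move=> jn; rewrite !mulrDr mulr1 !coefD ![_ * (_%:P * _)]mulrCA !coefCM !coefMXn !coef_poly.
rewrite ltnS jn; congr (_ + _ + _); case: ifP => _; rewrite ?mulr0 // ifT //; lia.
Qed.

Lemma first_top m (c : R) (g : nat -> R) t : (0 < m < N)%N ->
  eqmodX m.+1 (fibden R * U) (1 + c%:P * 'X^m) ->
  sqsum m g + (g m + c * g 0%N + t) ^+ 2 <=
  sqsum m (fibdiff g) + (fibdiff g m + t) ^+ 2
    + (alpha ^+ 2 - 1) * (\sum_(j < m.+1) alpha ^+ (m - j) * fibdiff g j + t) ^+ 2.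
Proof.
move=> /andP[m0 mN] BU.
have BU' : eqmodX m.+1 (fibden R * U) (1 + c%:P * 'X^m + 0%:P * 'X^(m.+1)).
  by move=> j jm; rewrite BU // mul0r addr0.
have := pattern_top U0 energyP g mN BU' t.
rewrite coef_patternM // ltnn subnn ltnSn addr0.
rewrite (@eq_sqsum _ m _ g) // => j jm.
by rewrite coef_patternM ?(ltnW jm) // jm ltnS (ltnW jm) !addr0.
Qed.

Lemma first_balanced m (c : R) (g : nat -> R) : (0 < m < N)%N ->
  eqmodX m.+1 (fibden R * U) (1 + c%:P * 'X^m) ->
  g m + c * g 0%N = fibdiff g m -> sqsum m g <= sqsum m (fibdiff g).
Proof.
move=> mN BU gm.
have := first_top g (- \sum_(j < m.+1) alpha ^+ (m - j) * fibdiff g j) mN BU.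
by rewrite gm subrr expr0n mulr0 addr0 lerD2r.
Qed.

Lemma second_balanced m (e : R) (g : nat -> R) : (0 < m)%N -> (m.+1 < N)%N ->
  eqmodX m.+2 (fibden R * U) (1 - 'X^m + e%:P * 'X^(m.+1)) ->
  g m.+1 - g 1%N + e * g 0%N = fibdiff g m.+1 ->
  sqsum m g + (g m - g 0%N) ^+ 2 <= sqsum m.+1 (fibdiff g).
Proof.
move=> m0 mN BU gm.
have BU' : eqmodX m.+2 (fibden R * U) (1 + (-1)%:P * 'X^m + e%:P * 'X^(m.+1)).
  by move=> j jm; rewrite BU // polyCN mulN1r.
have := pattern_balanced U0 energyP mN BU' (g := g).
rewrite coef_patternM // ltnNge leqnSn /= subSnn ltnn subnn mulN1r gm => /(_ erefl).
rewrite sqsumS coef_patternM // ltnn subnn ltnSn addr0 mulN1r.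
rewrite (@eq_sqsum _ m _ g) // => j jm.
by rewrite coef_patternM ?(leqW (ltnW jm)) // jm ltnS (ltnW jm) !addr0.
Qed.

(* The series 1 / (1 - X), perturbed at s: it is admissible in pattern_balanced
   for one value of the perturbation. *)
Definition spike (s : nat) (x : R) (j : nat) : R := if j == s then 1 + x else 1.

Arguments spike : simpl never.

Lemma spike_sqsum s (x : R) : sqsum s.+1 (spike s x) = s%:R + (1 + x) ^+ 2.
Proof.
rewrite sqsumS /spike eqxx; congr (_ + _).
rewrite -[s]add0n (@sqsum_const _ 0 s 1); first by rewrite sqsum0 add0r expr1n mulr1 add0n.
by move=> j jm; rewrite ltn_eqF //; lia.
Qed.

Lemma spike_fibdiff s x : (1 < s)%N ->
  sqsum s.+1 (fibdiff (spike s x)) = s%:R - 1 + (1 - x) ^+ 2.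
Proof.
case: s => [|[|s]] // _; rewrite sqsumS /= /spike eqxx.
have -> : (s.+1 == s.+2) = false by lia.
have -> : (s == s.+2) = false by lia.
rewrite -[s.+2]/(2 + s)%N (@sqsum_const _ 2 s (-1)).
  by rewrite !sqsumS sqsum0 /= natrD; ring.
move=> [|[|j]] // jm /=.
by rewrite !ltn_eqF; [ring | lia | lia | lia].
Qed.

Lemma spike_top s x : (0 < s)%N -> fibdiff (spike s x) s.+1 = - 1 - x.
Proof.
case: s => [|s] // _; rewrite /= /spike eqxx.
have -> : (s.+2 == s.+1) = false by lia.
have -> : (s == s.+1) = false by lia.
by ring.
Qed.

Lemma spike_at s (x : R) : spike s x s = 1 + x.
Proof. by rewrite /spike eqxx. Qed.

Lemma spike_low s x j : (j < s)%N -> spike s x j = 1.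
Proof. by move=> js; rewrite /spike ltn_eqF. Qed.

Lemma spike_high s x j : (s < j)%N -> spike s x j = 1.
Proof. by move=> js; rewrite /spike gtn_eqF. Qed.

Lemma first_coef_gt m (c : R) : (1 < m < N)%N ->
  eqmodX m.+1 (fibden R * U) (1 + c%:P * 'X^m) -> -2 < c.
Proof.
move=> /andP[m1 mN] BU; rewrite ltNge; apply/negP => c2.
have m0N : (0 < m < N)%N by rewrite mN (ltnW m1).
case: m m1 mN m0N BU => [|[|s]] // _ _ m0N BU.
(* The perturbation x = -(c + 2) balances the test. The inequality reads 1 + 4 x <= 0, or 1 + 2 x <=
   0 when m = 2, while x >= 0. *)
have := first_balanced (g := spike s.+1 (- (c + 2))) m0N BU.
rewrite spike_top // spike_high // spike_low // => /(_ _)/wrap[]; first by ring.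
rewrite spike_sqsum; case: s => [|s] in m0N BU *.
  by rewrite !sqsumS sqsum0 /= /spike /=; nra.
by rewrite spike_fibdiff //; nra.
Qed.

Lemma sum_tail_spike s : (0 < s)%N ->
  \sum_(j < s.+2) alpha ^+ (s.+1 - j) * fibdiff (spike s (-1/2)) j <= (alpha + 1) / 2.
Proof.
have [a1 a2] := (alpha_gt1, alpha_lt) => s0.
pose tv n (f : nat -> R) := \sum_(j < n.+1) alpha ^+ (n - j) * f j.
have tvS n f : tv n.+1 f = alpha * tv n f + f n.+1.
  rewrite /tv big_ord_recr /= subnn mul1r mulr_sumr; congr (_ + _).
  by apply: eq_bigr => i _; rewrite subSn ?exprS ?mulrA // -ltnS.
have tv0 f : tv 0%N f = f 0%N by rewrite /tv big_ord_recr big_ord0 /= add0r mul1r.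
rewrite -/(tv s.+1 _) tvS spike_top //; case: s s0 => [//|[|s]] _.
  by rewrite tvS tv0 /= /spike /=; nra.
(* Before the spike, every difference from index 2 on is -1, and alpha * alpha - 1 < alpha, so the
   bound alpha persists. *)
have low n : (n <= s)%N -> tv n.+1 (fibdiff (spike s.+2 (-1/2))) <= alpha.
  elim: n => [|n IH] ns; first by rewrite tvS tv0 /= !spike_low //; nra.
  by rewrite tvS /= !spike_low //; [have := IH (ltnW ns); nra | lia..].
have := low s (leqnn s); rewrite [tv s.+2 _]tvS /= spike_at !spike_low //.
set z := tv _ _ => zle; clearbody z.
have : alpha * z <= alpha ^+ 2 by rewrite expr2 ler_wpM2l //; lra.
by nra.
Qed.

Lemma first_coef_lt m (c : R) : (1 < m < N)%N ->
  eqmodX m.+1 (fibden R * U) (1 + c%:P * 'X^m) -> c < 1.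
Proof.
move=> /andP[m1 mN] BU; rewrite ltNge; apply/negP => c1.
have m0N : (0 < m < N)%N by rewrite mN (ltnW m1).
case: m m1 mN m0N BU => [|[|s]] // _ _ m0N BU.
have := sum_tail_spike (ltn0Sn s).
set tau := \sum_(j < _) _ => tau_le.
(* This t makes the tail value 3/2, close to the optimum (5/2) / (alpha^2 - 1) for c = 1 near the
   golden ratio. *)
have := first_top (spike s.+1 (-1/2)) (3 / 2 - tau) m0N BU.
rewrite spike_top // spike_high // spike_low // -/tau; clearbody tau.
have [a1 a2] := (alpha_gt1, alpha_lt); have alpha_ub := golden_ub a1 a2.
have excess : 1 + (alpha ^+ 2 - 1) * (tau + (3 / 2 - tau)) ^+ 2 <
    (1 + c * 1 + (3 / 2 - tau)) ^+ 2 - (- 1 - - 1 / 2 + (3 / 2 - tau)) ^+ 2.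
  have -> : (1 + c * 1 + (3 / 2 - tau)) ^+ 2 - (- 1 - - 1 / 2 + (3 / 2 - tau)) ^+ 2 =
      (c + 3 / 2) * (c + 7 / 2 - 2 * tau) by field.
  have : (5 / 2) * (7 / 2 - alpha) <= (c + 3 / 2) * (c + 7 / 2 - 2 * tau).
    by apply: ler_pM; lra.
  have -> : tau + (3 / 2 - tau) = 3 / 2 by ring.
  by nra.
rewrite spike_sqsum; case: s => [|s] in m0N BU *.
  by rewrite !sqsumS sqsum0 /= /spike /=; move: excess; lra.
by rewrite spike_fibdiff //; move: excess; lra.
Qed.

Lemma second_coef_gt m (e : R) : (1 < m)%N -> (m.+1 < N)%N ->
  eqmodX m.+2 (fibden R * U) (1 - 'X^m + e%:P * 'X^(m.+1)) -> -2 < e.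
Proof.
move=> m1 mN BU; rewrite ltNge; apply/negP => e2.
(* With x = -(e + 1) the test is balanced and yields 2 x <= 0, although x >= 1. *)
have := second_balanced (g := spike m (- (e + 1))) (ltnW m1) mN BU.
rewrite spike_top ?(ltnW m1) // spike_high //.
rewrite (@spike_low m _ 0) ?(ltnW m1) // (@spike_low m _ 1) //.
rewrite spike_fibdiff //.
have -> : sqsum m (spike m (- (e + 1))) = m%:R.
  rewrite -[m]add0n (@sqsum_const _ 0 m 1); first by rewrite sqsum0 add0r expr1n mulr1 add0n.
  by move=> j jm; rewrite spike_low //; lia.
rewrite {1}/spike eqxx => /(_ _)/wrap[]; first by ring.
by nra.
Qed.

(** The constant sequence g = 1 gives, modulo X^2, the test polynomial 1 + t X, with t adapted to
    each bound. *)
Lemma linear_coef_bounds (c : R) : (1 < N)%N ->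
  eqmodX 2 (fibden R * U) (1 + c%:P * 'X^1) -> -2 < c < 1.
Proof.
move=> N1 BU; have [a1 a2] := (alpha_gt1, alpha_lt).
have top t := @first_top 1 c (fun=> 1) t N1 BU.
have {}top t : (1 + c + t) ^+ 2 <= t ^+ 2 + (alpha ^+ 2 - 1) * (alpha + t) ^+ 2.
  have := top t; rewrite !sqsumS !sqsum0 !big_ord_recl big_ord0 /= expr1 expr0.
  by move=> le0; lra.
apply/andP; split; rewrite ltNge; apply/negP => c0.
  have := top (- alpha); rewrite subrr expr0n mulr0 addr0 => le0.
  have : 0 < (1 + c) * (1 + c - 2 * alpha) by rewrite nmulr_lgt0; lra.
  by nra.
(* At the golden ratio, where alpha^2 - 1 = alpha, this t maximises the difference of the two
   sides. *)
have := top (- alpha + (1 + c) / alpha).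
have -> : alpha + (- alpha + (1 + c) / alpha) = (1 + c) / alpha by ring.
set d := 1 + c; have d2 : 2 <= d by rewrite /d; lra.
clearbody d => {top} le0.
have alpha0 : 0 < alpha by lra.
have {}le0 : d * (2 * alpha + 1) <= 2 * alpha ^+ 3.
  rewrite -subr_le0 -(pmulr_rle0 _ (_ : 0 < d / alpha ^+ 2)); last first.
    by rewrite divr_gt0 ?exprn_gt0 //; lra.
  rewrite [X in X <= _](_ : _ = (d + (- alpha + d / alpha)) ^+ 2 -
    ((- alpha + d / alpha) ^+ 2 + (alpha ^+ 2 - 1) * (d / alpha) ^+ 2)).
    by rewrite subr_le0.
  by field; lra.
have : alpha ^+ 3 < 2 * alpha + 1 by nra.
by nra.
Qed.

Lemma second_coef_lt m (e : R) : (3 < m)%N -> (m.+1 < N)%N ->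
  eqmodX m.+2 (fibden R * U) (1 - 'X^m + e%:P * 'X^(m.+1)) -> e < 1.
Proof.
move=> m3 mN BU; rewrite ltNge; apply/negP => e1.
(* The values -e balance the test; the value (1 - e) / 2 at index 2 maximises the excess, which is 2
   e^2 - (e - 1)^2 / 2 > 0. *)
pose g j : R := if j == 0%N then 1 else if j == 2 then (1 - e) / 2 else - e.
case: m m3 mN BU => [|[|[|[|k]]]] // _ mN BU.
have := @second_balanced k.+4 e g isT mN BU.
rewrite /= /g /= => /(_ _)/wrap[]; first by ring.
rewrite -[k.+4]/(3 + k.+1)%N (@sqsum_const _ 3 k.+1 (- e)).
  rewrite -[(3 + k.+1).+1]/(5 + k)%N (@sqsum_const _ 5 k e).
    by rewrite !sqsumS !sqsum0 /= -[k.+1]addn1 natrD; nra.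
  by case=> [|[|[|[|[|j]]]]] //= _; ring.
by case=> [|[|[|j]]].
Qed.

(** From index 6 on the test sequence repeats -6, 0, and from index 7 on its differences repeat 6,
    0, so both sides grow alike with k. They are 233 + 36 k and 227 + 36 k, in the wrong order. *)
Lemma second_coef_even_neq0 k : (k.*2.+4.+3 < N)%N ->
  ~ eqmodX k.*2.+4.+4 (fibden R * U) (1 - 'X^(k.*2.+4.+2) + 0%:P * 'X^(k.*2.+4.+3)).
Proof.
move=> mN BU.
pose g j : R := match j with 0 => 6 | 1 => -6 | 2 => 2 | 3 => -3 | 4 => -2 | 5 => 0
                | i => if odd i then 0 else -6 end.
have := @second_balanced k.*2.+4.+2 0 g isT mN BU.
rewrite /= !negbK odd_double /= => /(_ _)/wrap[]; first by case: (k.*2) => [|?]; ring.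
rewrite -[k.*2.+4.+2]/(6 + k.*2)%N (@sqsum_alt _ 6 k (- 6) 0).
- rewrite -[(6 + k.*2).+1]/(7 + k.*2)%N (@sqsum_alt _ 7 k 6 0).
  + by rewrite !sqsumS !sqsum0 /=; lra.
  + by case=> [|i] _ /=; rewrite ?negbK ?odd_double /=; ring.
  + by move=> i _; rewrite /= ?negbK odd_double /=; ring.
- by move=> i _; rewrite /= ?negbK odd_double.
- by move=> i _; rewrite /= ?negbK odd_double.
Qed.

(** The right-hand side is exactly the slack of a balanced test; for an integer x it forces x =
    0. *)
Lemma exceptional_coef (x : R) : (6 < N)%N ->
  eqmodX 7 (fibden R * U) (1 - 'X^4 + x%:P * 'X^6) -> 0 <= x * (2 - 3 * x).
Proof.
move=> N6 BU.
pose g j : R := match j with 0 => 1 | 1 => 2 * x - 1 | 2 => 1 - 2 * x | 3 => 0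
                | 4 => - x | 5 => 1 - 2 * x | _ => 0 end.
have := pattern_balanced U0 energyP N6 BU (g := g).
have E j : ((\poly_(i < 7) g i) * (1 - 'X^4 + x%:P * 'X^6))`_j =
    (if (j < 7)%N then g j else 0)
    - (if (j < 4)%N then 0 else if (j - 4 < 7)%N then g (j - 4)%N else 0)
    + (if (j < 6)%N then 0 else x * (if (j - 6 < 7)%N then g (j - 6)%N else 0)).
  rewrite mulrDr mulrBr mulr1 [_ * (_%:P * _)]mulrCA coefD coefB coefCM !coefMXn !coef_poly.
  by case: (j < 6)%N; rewrite ?mulr0.
rewrite E /= => /(_ _)/wrap[]; first by ring.
by rewrite !sqsumS !sqsum0 !E /=; nra.
Qed.

(** * Coefficients beyond the pattern 1 - X^2 *)

(** The analogue of [fibdiff] for 1 - X^2. *)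
Definition shiftdiff (g : nat -> R) j : R := g j - (if j is i.+2 then g i else 0).

(** [fibdiff g j] is [shiftdiff g j] minus g_(j-1), and the cross terms g_j g_(j-1) - g_(j-1)
    g_(j-2) telescope. *)
Lemma sqsum_fibdiff k g :
  sqsum k.+2 (fibdiff g) =
  sqsum k.+2 (shiftdiff g) + sqsum k.+1 g - 2 * g k.+1 * g k.
Proof.
elim: k => [|k IH]; first by rewrite !sqsumS !sqsum0 /shiftdiff /=; ring.
by rewrite sqsumS IH [sqsum k.+3 _]sqsumS [sqsum k.+2 g]sqsumS /shiftdiff /=; ring.
Qed.

Lemma sqsum_ends k g : (forall j, (0 < j < k.+1)%N -> g j = 0 :> R) ->
  sqsum k.+2 g = g 0%N ^+ 2 + g k.+1 ^+ 2.
Proof.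
move=> g0; rewrite sqsumS -[sqsum k.+1 g]/(sqsum (1 + k) g) (@sqsum_const _ 1 k 0) //.
by rewrite sqsumS sqsum0; ring.
Qed.

(** Collecting the weights of each g_i, all but the last two are multiples of alpha^2 - alpha - 1,
    which is negative below the golden ratio. *)
Lemma tail_fibdiff k g :
  \sum_(j < k.+2) alpha ^+ (k.+1 - j) * fibdiff g j =
  g k.+1 + (alpha - 1) * g k
  + (alpha ^+ 2 - alpha - 1) * \sum_(i < k) alpha ^+ (k - i.+1) * g i.
Proof.
elim: k => [|k IH].
  by rewrite !big_ord_recl !big_ord0 /= expr0 expr1; ring.
rewrite big_ord_recr /= subnn expr0.
have -> : \sum_(i < k.+2) alpha ^+ (k.+2 - i) * fibdiff g i =
    alpha * \sum_(i < k.+2) alpha ^+ (k.+1 - i) * fibdiff g i.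
  by rewrite mulr_sumr; apply: eq_bigr => i _; rewrite subSn ?exprS ?mulrA // -ltnS.
rewrite IH [in RHS]big_ord_recr /= subnn expr0.
have -> : \sum_(i < k) alpha ^+ (k.+1 - i.+1) * g i =
    alpha * \sum_(i < k) alpha ^+ (k - i.+1) * g i.
  by rewrite mulr_sumr; apply: eq_bigr => i _; rewrite subSn ?exprS ?mulrA //.
by ring.
Qed.

Lemma shift_top k (c : R) g t : (k.+3 < N)%N ->
  eqmodX k.+4 (fibden R * U) (1 - 'X^2 + c%:P * 'X^(k.+3)) ->
  sqsum k.+3 (shiftdiff g) + (shiftdiff g k.+3 + c * g 0%N + t) ^+ 2 <=
  sqsum k.+3 (fibdiff g) + (fibdiff g k.+3 + t) ^+ 2
    + (alpha ^+ 2 - 1) * (\sum_(j < k.+4) alpha ^+ (k.+3 - j) * fibdiff g j + t) ^+ 2.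
Proof.
move=> mN BU; have := pattern_top U0 energyP g mN BU t.
have E j : (j < k.+4)%N -> ((\poly_(i < k.+4) g i) * (1 - 'X^2 + c%:P * 'X^(k.+3)))`_j =
    shiftdiff g j + (if (j < k.+3)%N then 0 else c * g (j - k.+3)%N).
  move=> jk; rewrite mulrDr mulrBr mulr1 [_ * (_%:P * _)]mulrCA coefD coefB coefCM.
  rewrite !coefMXn !coef_poly jk.
  congr (_ + _); last by case: ifP => _; rewrite ?mulr0 // ifT //; lia.
  by case: j jk => [|[|j]] jk //=; rewrite !subSS subn0 ifT //; lia.
rewrite E // ltnn subnn (@eq_sqsum _ k.+3 _ (shiftdiff g)) // => j jk.
by rewrite E ?jk ?addr0 // ltnS ltnW.
Qed.

Lemma shift_coef_lt k (c : R) : (k.+3 < N)%N ->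
  eqmodX k.+4 (fibden R * U) (1 - 'X^2 + c%:P * 'X^(k.+3)) -> c < 1.
Proof.
move=> mN BU; have [a1 a2] := (alpha_gt1, alpha_lt).
rewrite ltNge; apply/negP => c1.
(* For this g the energies of [fibdiff] and [shiftdiff] differ by 2, and the tail value tau is
   nonpositive. The test becomes c (c + 2 (1 - tau)) <= 2, which fails for c >= 1. *)
pose g j : R := if j == 0%N then 1 else if j == k.+1 then -1 else 0.
have := shift_top g (- \sum_(j < k.+4) alpha ^+ (k.+3 - j) * fibdiff g j) mN BU.
have -> : \sum_(j < k.+4) alpha ^+ (k.+3 - j) * fibdiff g j =
    (alpha ^+ 2 - alpha - 1) * (alpha ^+ k.+1 - 1).
  rewrite tail_fibdiff big_ord_recl big_ord_recr /= /bump /= !add1n.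
  rewrite big1 => [|i _]; last first.
    by rewrite /g /= add1n eqSS ltn_eqF ?mulr0 //; have := ltn_ord i; lia.
  rewrite /g /= !eqSS eqxx !gtn_eqF //; try lia.
  by rewrite subnn expr0 subn1 /=; ring.
have ak : 1 <= alpha ^+ k.+1 by rewrite exprn_ege1 // ltW.
have -> : sqsum k.+3 (fibdiff g) = sqsum k.+3 (shiftdiff g) + 2.
  rewrite sqsum_fibdiff [sqsum k.+2 g]sqsum_ends => [|[|j] // jk].
    by rewrite /g /= !eqSS !eqxx gtn_eqF //; ring.
  by rewrite /g /= eqSS ltn_eqF.
rewrite /= /shiftdiff /g /= !eqSS eqxx ?gtn_eqF //.
have : (alpha ^+ 2 - alpha - 1) * (alpha ^+ k.+1 - 1) <= 0.
  by rewrite mulr_le0_ge0 //; lra.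
move: (_ * _) (sqsum _ _) => tau s tau0.
rewrite [tau - tau]subrr expr0n mulr0 addr0 => le2.
have {}le2 : c * (c + 2 * (1 - tau)) <= 2 by lra.
by nra.
Qed.

Lemma shift_coef_ge k (c : R) : (k.+3 < N)%N ->
  eqmodX k.+4 (fibden R * U) (1 - 'X^2 + c%:P * 'X^(k.+3)) -> -1 <= c.
Proof.
move=> mN BU.
(* The two entries -c balance the top coefficient; what remains is c^2 <= 1. *)
pose g j : R := if j == 0%N then 1 else if (j == k.+1) || (j == k.+2) then - c else 0.
have := shift_top g (- \sum_(j < k.+4) alpha ^+ (k.+3 - j) * fibdiff g j) mN BU.
rewrite subrr expr0n mulr0 addr0.
have -> : sqsum k.+3 (fibdiff g) = sqsum k.+3 (shiftdiff g) + 1 - c ^+ 2.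
  rewrite sqsum_fibdiff [sqsum k.+2 g]sqsum_ends => [|[|j] // jk].
    by rewrite /g /= !eqSS !eqxx orbT /=; ring.
  by rewrite /g /= !eqSS !ltn_eqF //; lia.
have -> : shiftdiff g k.+3 + c * g 0%N = fibdiff g k.+3.
  rewrite /= /shiftdiff /g /= !eqSS !eqxx orbT /=.
  by rewrite !gtn_eqF //; ring.
by rewrite lerD2r => c2; nra.
Qed.

(* The reversed polynomial has the same energy, so that h has no slack; the free
   top coefficient is used to cancel its tail value. *)
Lemma reversed_image n (h : {poly R}) : (n < N)%N -> (size h <= n.+1)%N ->
  h`_0 = 1 -> h`_n = -1 -> eqmodX n.+1 (h * U) (- revp n h) ->
  exists t, eqmodX N ((h + t *: 'X^n) * U) (- revp n h + t *: 'X^n).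
Proof.
move=> nN sh h0 hn hU; exists (- tailval alpha n h).
set t := - _; have sXn : (size (t *: 'X^n : {poly R}) <= n.+1)%N.
  by rewrite (leq_trans (size_scale_leq _ _)) // size_polyXn.
apply: (energy_null energyP nN).
- by rewrite (leq_trans (size_polyD _ _)) // geq_max sh.
- by rewrite (leq_trans (size_polyD _ _)) // geq_max size_polyN size_poly.
- by rewrite tailval_addXn subrr.
- move=> j; rewrite ltnS leq_eqVlt => /orP[/eqP ->|jn].
    by rewrite mulU_addXn // coef_addXn hU.
  by rewrite mulU_addXn_low // coef_addXn_low // hU // ltnS ltnW.
have rn : (- revp n h)`_n = -1 by rewrite coefN coef_poly ltnSn subnn h0.
rewrite !energyS !coef_addXn rn hn; congr (_ + _).
rewrite (@eq_energy _ n _ (- revp n h)) => [|j jn]; last by rewrite coef_addXn_low.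
rewrite (@eq_energy _ n (h + _) h) => [|j jn]; last by rewrite coef_addXn_low.
have: energy n.+1 (- revp n h) = energy n.+1 h.
  rewrite /energy (reindex_inj rev_ord_inj) /=; apply: eq_bigr => i _.
  rewrite coefN coef_poly normrN subSS ltnS leq_subr subKn //.
  by rewrite -ltnS.
by rewrite !energyS rn hn => /addIr.
Qed.

End Exclusion.

(** * Pisot numbers below the golden ratio *)

Notation toQ := (map_poly (intr : int -> rat)).

Lemma map_ratr_int (F : numFieldType) (p : {poly int}) :
  map_poly (ratr : rat -> F) (toQ p) = map_poly intr p.
Proof. by apply/polyP => i; rewrite !coef_map /= ratr_int. Qed.

(** * Polynomials and their reversals *)

Lemma horner_revp (F : fieldType) d (p : {poly F}) x :
  (size p <= d.+1)%N -> x != 0 -> (revp d p).[x] = x ^+ d * p.[x^-1].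
Proof.
move=> sp x0; rewrite (horner_coef_wide _ (size_poly _ _)) (horner_coef_wide _ sp).
rewrite mulr_sumr (reindex_inj rev_ord_inj) /=; apply: eq_bigr => i _.
have id : (i <= d)%N by rewrite -ltnS.
rewrite coef_poly subSS ltnS leq_subr subKn // mulrCA; congr (_ * _).
by rewrite exprVn -expfB_cond ?(negPf x0) ?orbT // id.
Qed.

Lemma coef_exp0 (A : comNzRingType) (p : {poly A}) n j :
  p`_0 = 0 -> (j < n)%N -> (p ^+ n)`_j = 0.
Proof.
move=> p0; elim: n j => [//|n IH] j jn; rewrite exprS coefM big1 // => -[[|i] /= ij] _.
  by rewrite p0 mul0r.
by rewrite IH ?mulr0 //; lia.
Qed.

Lemma root_dvd (F : fieldType) (p q : {poly F}) x : p %| q -> root p x -> root q x.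
Proof. by move=> pq; rewrite -!dvdp_XsubCl => /dvdp_trans; apply. Qed.

Lemma norm_1subC (R : rcfType) (x : R) : `|1 - x| < 1 -> `|1 - x%:C%C| < 1 :> R[i].
Proof.
have -> : 1 - x%:C%C = (1 - x)%:C%C by rewrite rmorphB rmorph1.
by rewrite normc_def /= expr0n addr0 sqrtr_sqr -(ltcR _ 1).
Qed.

Lemma eqmodX_eq (A : comNzRingType) n (p q : {poly A}) :
  (size p <= n)%N -> (size q <= n)%N -> eqmodX n p q -> p = q.
Proof.
move=> sp sq pq; apply/polyP => j; have [/pq //|nj] := ltnP j n.
by rewrite !nth_default // (leq_trans _ nj).
Qed.

Lemma horner1_revp (A : comNzRingType) k (p : {poly A}) :
  (size p <= k.+1)%N -> (revp k p).[1] = p.[1].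
Proof.
move=> sp; rewrite (horner_coef_wide _ (size_poly _ _)) (horner_coef_wide _ sp).
rewrite (reindex_inj rev_ord_inj) /=; apply: eq_bigr => i _.
by rewrite coef_poly subSS ltnS leq_subr subKn ?expr1n // -ltnS.
Qed.

Lemma revpD (A : comNzRingType) n (p q : {poly A}) :
  revp n (p + q) = revp n p + revp n q.
Proof.
by apply/polyP => i; rewrite coefD !coef_poly coefD; case: ifP; rewrite ?addr0.
Qed.

Lemma revpN (A : comNzRingType) n (p : {poly A}) : revp n (- p) = - revp n p.
Proof.
by apply/polyP => i; rewrite coefN !coef_poly coefN; case: ifP; rewrite ?oppr0.
Qed.

Lemma revpZ (A : comNzRingType) n (a : A) (p : {poly A}) :
  revp n (a%:P * p) = a%:P * revp n p.
Proof.
by apply/polyP => i; rewrite coefCM !coef_poly coefCM; case: ifP; rewrite ?mulr0.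
Qed.

Lemma revpXn (A : comNzRingType) n i j : (i + j = n)%N ->
  revp n ('X^i : {poly A}) = 'X^j.
Proof.
move=> <-; apply/polyP => k; rewrite coef_poly !coefXn.
case: ltnP => kn.
  by rewrite (_ : (i + j - k == i)%N = (k == j)%N) //; lia.
by rewrite (_ : (k == j)%N = false) //; lia.
Qed.

Lemma revp1 (A : comNzRingType) n : revp n (1 : {poly A}) = 'X^n.
Proof. by rewrite -(expr0 'X); apply: revpXn. Qed.

Lemma revpX (A : comNzRingType) n : revp n.+1 ('X : {poly A}) = 'X^n.
Proof. exact: (@revpXn A n.+1 1). Qed.

Lemma revp_sum (A : comNzRingType) n k (F : nat -> {poly A}) :
  revp n (\sum_(i < k) F i) = \sum_(i < k) revp n (F i).
Proof.
elim: k => [|k IH]; last by rewrite !big_ord_recr /= revpD IH.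
by rewrite !big_ord0; apply/polyP => i; rewrite coef_poly !coef0; case: ifP.
Qed.

Lemma eqmodX_add_mulXn (A : comNzRingType) n (p q w : {poly A}) :
  p = q + 'X^n * w -> eqmodX n p q.
Proof. by move=> -> j jn; rewrite coefD coefXnM jn addr0. Qed.

Lemma size_polyM_le (A : nzRingType) a b c (p q : {poly A}) :
  (size p <= a)%N -> (size q <= b)%N -> ((a + b).-1 <= c)%N -> (size (p * q)%R <= c)%N.
Proof.
move=> pa qb; apply: leq_trans; apply: leq_trans (size_polyMleq _ _) _.
by rewrite -!subn1 leq_sub2r // leq_add.
Qed.

Lemma bezout_coprime (F : fieldType) (h r D a b : {poly F}) :
  a * h + b * r = D -> coprimep h D -> coprimep h r.
Proof.
move=> <- /coprimepP hD; apply/coprimepP => e eh er; apply: hD => //.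
by rewrite dvdp_add ?dvdp_mull.
Qed.

Lemma coprimep_Xsub1 (h : {poly int}) : coprimep (toQ h) ('X - 1) = (h.[1] != 0).
Proof.
by rewrite -[X in _ - X]polyC1 coprimep_XsubC /root -(rmorph1 (intr : int -> rat))
  horner_map /= intr_eq0.
Qed.

Lemma coprimep_Xadd1 (h : {poly int}) : coprimep (toQ h) ('X + 1) = (h.[-1] != 0).
Proof.
have -> : 'X + 1 = 'X - ((-1)%:~R)%:P :> {poly rat}.
  by rewrite mulrN1z polyCN polyC1 opprK.
by rewrite coprimep_XsubC /root horner_map /= intr_eq0.
Qed.

(** * The minimal polynomial P, its reversal Q and the series P(0) P / Q *)

Section Pisot.
Variables (R : rcfType) (alpha : R) (P : {poly int}).
Hypotheses (alpha_gt1 : 1 < alpha) (alpha_lt : alpha ^+ 2 < alpha + 1).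
Hypotheses (P_monic : P \is monic) (irrP : irreducible_poly (toQ P)).
Hypothesis rootP : root (map_poly (intr : int -> R) P) alpha.
Hypothesis conjP : forall w : R[i],
  root (map_poly intr P) w -> w != alpha%:C%C -> `|w| < 1.

Local Notation toR := (map_poly (intr : int -> R)).
Local Notation toC := (map_poly (real_complex R)).
Local Notation d := (size P).-1.
Local Notation Q := (revp d P).

Lemma sizeP : size P = d.+1.
Proof. by have [+ _] := irrP; rewrite size_rat_int_poly; case: (size P). Qed.

Lemma map_complex_int (p : {poly int}) : toC (toR p) = map_poly intr p.
Proof. by apply/polyP => i; rewrite !coef_map /= rmorph_int. Qed.

Lemma real_conj (x : R) : root (toR P) x -> x != alpha -> `|x| < 1.
Proof.
move=> rx xa; have := @conjP x%:C%C.
rewrite -map_complex_int fmorph_root => /(_ rx).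
rewrite (inj_eq (fmorph_inj _)) => /(_ xa).
by rewrite normc_def /= expr0n addr0 sqrtr_sqr ltcR.
Qed.

Lemma horner_neq0 (x : R) : 1 <= `|x| -> x != alpha -> (toR P).[x] != 0.
Proof. by move=> x1 xa; apply/negP => /real_conj/(_ xa); rewrite ltNge x1. Qed.

Lemma irr_coprime (p : {poly rat}) : (size p < size P)%N -> p != 0 ->
  coprimep (toQ P) p.
Proof.
move=> sp p0; rewrite irreducible_poly_coprime //; apply/negP => /(dvdp_leq p0).
by rewrite size_rat_int_poly leqNgt sp.
Qed.

(** An irreducible polynomial over the rationals is coprime to its derivative, so alpha is not a
    root of the cofactor. *)
Lemma simple_root : exists P1 : {poly R}, [/\ toR P = ('X - alpha%:P) * P1,
  P1 \is monic, size P1 = d &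
  forall w : R[i], root (toC P1) w -> `|w| < 1].
Proof.
have [P1 def_P] := factor_theorem _ _ rootP.
exists P1; rewrite mulrC.
have mP1 : P1 \is monic.
  by rewrite -(monicMr _ (monicXsubC alpha)) -def_P monic_map.
split=> //.
  have := size_rat_int_poly P; rewrite -(size_map_poly (ratr : {rmorphism rat -> R})).
  rewrite map_ratr_int def_P size_Mmonic ?monic_neq0 ?monicXsubC // size_XsubC addn2 /=.
  by move=> <-.
move=> w rw.
have rPw : root (map_poly intr P) w.
  by rewrite -map_complex_int def_P rmorphM rootM rw.
apply: conjP => //; apply/eqP => wa; move: rw; rewrite wa fmorph_root => rP1.
have /coprimep_root : coprimep (toR P) (toR P)^`().
  have -> : toR P = map_poly ratr (toQ P) by rewrite map_ratr_int.
  rewrite deriv_map coprimep_map; apply: irr_coprime.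
    by rewrite -size_rat_int_poly lt_size_deriv // irredp_neq0.
  apply/negP => /eqP/(congr1 (fun p : {poly rat} => p`_d.-1)).
  rewrite coef0 coef_deriv coef_map prednK; last first.
    by have [+ _] := irrP; rewrite size_rat_int_poly; case: (size P) => [|[]].
  move: (monicP P_monic); rewrite /lead_coef => -> /eqP.
  have [+ _] := irrP; rewrite size_rat_int_poly.
  by case: (size P) => [|[|k]] //= _; rewrite pnatr_eq0.
move=> /(_ _ rootP); rewrite def_P derivM derivXsubC mulr1 hornerD hornerM hornerXsubC.
by rewrite subrr mulr0 add0r (eqP rP1) eqxx.
Qed.

Lemma coprime_or_root (p : {poly int}) :
  coprimep (toQ P) (toQ p) \/ root (toR p) alpha.
Proof.
have [cP|b] := boolP (coprimep (toQ P) (toQ p)); [by left|right].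
move: b; rewrite irreducible_poly_coprime // negbK => dP.
by move: rootP; rewrite -!(map_ratr_int R); apply: root_dvd; rewrite dvdp_map.
Qed.

Lemma coprime_horner (F : numFieldType) (p q : {poly int}) (x : F) :
  coprimep (toQ p) (toQ q) -> root (map_poly intr p) x ->
  (map_poly intr q).[x] != 0.
Proof.
rewrite -(coprimep_map (ratr : {rmorphism rat -> F})) !map_ratr_int.
exact: coprimep_root.
Qed.

Lemma horner_int_neq0 (x : int) : 1 <= `|x| -> x%:~R != alpha -> P.[x] != 0.
Proof.
move=> x1 xa; have := @horner_neq0 x%:~R; rewrite horner_map /= intr_eq0; apply=> //.
by rewrite -intr_norm -[1]/(1%:~R) ler_int.
Qed.

Lemma constant_neq0 : P`_0 != 0.
Proof.
have [cP|] := coprime_or_root 'X; last first.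
  by rewrite map_polyX /root hornerX gt_eqF //; apply: lt_trans alpha_gt1.
rewrite coprimep_sym in cP.
have := coprime_horner (x := 0 : rat) cP; rewrite map_polyX /root hornerX eqxx => /(_ isT).
by rewrite horner_coef0 coef_map /= intr_eq0.
Qed.

Lemma size_PR : (size (toR P) <= d.+1)%N.
Proof. by rewrite (leq_trans (size_poly _ _)) // sizeP. Qed.

Lemma alpha_neq0 : alpha != 0.
Proof. by rewrite gt_eqF //; apply: lt_trans alpha_gt1. Qed.

(** If 1/alpha were a root, P would divide its reversal and the roots would be stable under
    inversion. A root w other than alpha and 1/alpha would then have both |w| < 1 and 1/|w| < 1. The
    two remaining candidates satisfy |1 - w| < 1, so the integer P(1) would be 0, but 1 is not a
    root. *)
Lemma inv_alpha_neq_root : ~~ root (toR P) alpha^-1.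
Proof.
apply/negP => inv_root.
have rootQ : root (toR Q) alpha.
  rewrite /root map_revp horner_revp ?alpha_neq0 ?size_PR //.
  by rewrite (eqP inv_root) mulr0.
have dQ : toQ P %| toQ Q.
  have: ~~ coprimep (toQ P) (toQ Q).
    by apply/negP => /coprime_horner/(_ rootP); rewrite (eqP rootQ) eqxx.
  by rewrite irreducible_poly_coprime // negbK.
have [ws def_P] := closed_field_poly_normal (map_poly (intr : int -> R[i]) P).
rewrite lead_coef_map_inj ?rmorph0 // in def_P; last exact: intr_inj.
rewrite (monicP P_monic) scale1r in def_P.
have small w : w \in ws -> `|1 - w| < 1.
  move=> wws; have rw : root (map_poly intr P) w by rewrite def_P root_prod_XsubC.
  have w0 : w != 0.
    apply: contraTneq rw => ->.
    by rewrite /root horner_coef0 coef_map /= intr_eq0 constant_neq0.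
  have rwV : root (map_poly intr P) w^-1.
    have : root (map_poly (intr : int -> R[i]) Q) w.
      move: rw; rewrite -!(map_ratr_int R[i]); by apply: root_dvd; rewrite dvdp_map.
    rewrite /root map_revp horner_revp //; last first.
      by rewrite (leq_trans (size_poly _ _)) // sizeP.
    by rewrite mulf_eq0 expf_eq0 (negPf w0) andbF.
  have [->|wa] := eqVneq w (alpha%:C)%C.
    by apply: norm_1subC; rewrite ltr_norml; have := alpha_gt1; have := alpha_lt; nra.
  have [wVa|wVa] := eqVneq w^-1 (alpha%:C)%C; last first.
    have := conjP rwV wVa; rewrite normfV invf_lt1 ?normr_gt0 //.
    by rewrite lt_gtF // conjP.
  rewrite -[w]invrK wVa -fmorphV; apply: norm_1subC.
  have aV : 0 < alpha^-1 < 1.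
    by rewrite invr_gt0 invf_lt1 ?alpha_gt1 ?(lt_trans _ alpha_gt1).
  by rewrite ltr_norml; lra.
have P1_lt1 : `|(map_poly (intr : int -> R[i]) P).[1]| < 1.
  rewrite def_P horner_prod normr_prod.
  have : (0 < size ws)%N.
    have := size_prod_XsubC ws id; rewrite -def_P.
    have [+ _] := irrP; rewrite size_rat_int_poly => s1.
    rewrite size_map_inj_poly ?rmorph0 //; last exact: intr_inj.
    by case: (size ws) => // e; move: s1; rewrite e.
  case: ws {def_P} small => // w ws small _; rewrite big_cons hornerXsubC.
  apply: le_lt_trans (small w (mem_head _ _)).
  rewrite ler_piMr // big_seq; apply: prodr_ile1 => v vws.
  by rewrite normr_ge0 hornerXsubC ltW // small // in_cons vws orbT.
have := @horner_int_neq0 1 (lexx _); rewrite lt_eqF //= => /(_ isT).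
move: P1_lt1; rewrite -[1 : R[i]]/(1%:~R) horner_map /= -intr_norm ltr_int.
by move: (P.[1]) => z; lia.
Qed.

(** The geometric series of 1/Q, correct modulo X^N since Q(0) = 1. Polynomials modulo a large power
    of X stand for power series. *)
Definition inv_rev (N : nat) : {poly int} := \sum_(i < N) (1 - Q) ^+ i.

Lemma rev_coef0 : Q`_0 = 1.
Proof. by rewrite coef_poly /= subn0; exact: (monicP P_monic). Qed.

Lemma rev_inv_rev N : eqmodX N (Q * inv_rev N) 1.
Proof.
move=> j jN; have -> : Q * inv_rev N = 1 - (1 - Q) ^+ N.
  by rewrite -[RHS]opprB subrX1 -mulNr opprB subKr.
by rewrite coefB coef_exp0 ?subr0 // coefB coef1 rev_coef0 subrr.
Qed.

(** The sign e is left open: the case e = 1 serves to show that P(0) is a unit, after which e = P(0)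
    is used. *)
Lemma energy_int N n (e : int) (h : {poly R}) : e ^+ 2 = 1 -> (n < N)%N ->
  energy n.+1 (h * toR (e%:P * P * inv_rev N)) <=
  energy n.+1 h + (alpha ^+ 2 - 1) * tailval alpha n h ^+ 2.
Proof.
move=> e2 nN; have [P1 [def_P monicP1 sizeP1 rootsP1]] := simple_root.
have d0 : (0 < d)%N by rewrite -sizeP1 size_poly_gt0 monic_neq0.
apply: (@energy_ineq R alpha e%:~R d.-1 N P1) => //; first by rewrite prednK.
  by rewrite -rmorphXn /= e2.
move=> j jN; rewrite prednK // -def_P -map_revp -rmorphM.
have -> : Q * (e%:P * P * inv_rev N) = e%:P * P * (Q * inv_rev N) by ring.
rewrite coef_map /= (@eqmodX_mull _ N _ _ 1) ?mulr1 //; last exact: rev_inv_rev.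
by rewrite coefCM coefZ coef_map /= rmorphM.
Qed.

(** For h = 1 and n = 0 the energy inequality reads P(0)^2 <= alpha^2 < 3. *)
Lemma constant_unit : P`_0 ^+ 2 = 1.
Proof.
have := @energy_int 1 0 1 1 (expr1n _ _) isT.
rewrite mul1r !energyS /energy !big_ord0 tailval0 !coef_map /= coef1 eqxx /=.
rewrite !add0r !expr1n mulr1 addrC subrK mul1r coefM big_ord1 /= /inv_rev big_ord1.
rewrite expr0 coef1 mulr1 -rmorphXn /= => le_a.
have lt3 : alpha ^+ 2 < 3%:~R by have := alpha_gt1; have := alpha_lt; nra.
have := le_lt_trans le_a lt3; rewrite ltr_int.
have := constant_neq0; move: (P`_0) => z z0; rewrite expr2 => z3.
have z_ub : z <= 1 by nia.
have z_lb : -1 <= z by nia.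
by have [->|->] : z = 1 \/ z = -1 by lia.
Qed.

Definition quot_series (N : nat) : {poly int} := (P`_0)%:P * P * inv_rev N.

Lemma quot_coef0 N : (0 < N)%N -> (quot_series N)`_0 = 1.
Proof.
move=> N0; rewrite /quot_series -mulrA coefCM coefM big_ord1 /=.
have := @rev_inv_rev N 0 N0; rewrite coefM big_ord1 /= rev_coef0 mul1r coef1 => ->.
by rewrite mulr1 -expr2 constant_unit.
Qed.

Lemma rev_quot N : eqmodX N (Q * quot_series N) ((P`_0)%:P * P).
Proof.
have -> : Q * quot_series N = (P`_0)%:P * P * (Q * inv_rev N) by rewrite /quot_series; ring.
rewrite -[X in eqmodX _ _ X]mulr1; apply: eqmodX_mull; exact: rev_inv_rev.
Qed.

Lemma sizeQ : (size Q <= d.+1)%N. Proof. exact: size_poly. Qed.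

Lemma horner1_neq0 : (toR P).[1] != 0.
Proof. by apply: horner_neq0; rewrite ?normr1 // lt_eqF. Qed.

(** Since N exceeds all degrees involved, [reversed_image] gives an exact identity, which reduces to
    P h = Q (revp n h). As P is coprime to Q, it divides [revp n h]; the cofactor also divides h,
    hence is a constant, and it is 1 because both polynomials are monic. *)
Lemma pisot_poly_reversed N n (h : {poly int}) :
  (n + d.+1 < N)%N -> (size h <= n.+1)%N -> h`_0 = 1 -> h`_n = -1 -> h.[1] != 0 ->
  eqmodX n.+1 (h * quot_series N) (- revp n h) ->
  coprimep (toQ h) (toQ (revp n h)) -> P = revp n h.
Proof.
move=> nN sh h0 hn h1 hU cop.
have nN' : (n < N)%N by lia.
have U0 : (toR (quot_series N))`_0 = 1 by rewrite coef_map quot_coef0 //; lia.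
have en k g kN := @energy_int N k (P`_0) g constant_unit kN.
have [||||t] := @reversed_image _ alpha N (toR (quot_series N)) U0 en n (toR h) nN'.
- by rewrite (leq_trans (size_poly _ _)).
- by rewrite coef_map h0.
- by rewrite coef_map /= hn mulrN1z.
- by move=> j jn; rewrite -map_revp -rmorphM -rmorphN /= !coef_map hU.
rewrite -map_revp => ht.
have {ht}ht : (toR h + t *: 'X^n) * ((P`_0)%:~R *: toR P) =
              toR Q * (- toR (revp n h) + t *: 'X^n).
  have sM (p q : {poly R}) : (size p <= n.+1)%N -> (size q <= d.+1)%N ->
      (size (p * q)%R <= N)%N.
    by move=> sp sq; rewrite (leq_trans (size_polyMleq _ _)) //; lia.
  have sXn (p : {poly R}) : (size p <= n.+1)%N -> (size (p + t *: 'X^n)%R <= n.+1)%N.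
    move=> sp; rewrite (leq_trans (size_polyD _ _)) // geq_max sp.
    by rewrite (leq_trans (size_scale_leq _ _)) // size_polyXn.
  apply: (@eqmodX_eq _ N).
  - apply: sM; first by rewrite sXn // (leq_trans (size_poly _ _)).
    by rewrite (leq_trans (size_scale_leq _ _)) // size_PR.
  - rewrite mulrC; apply: sM; last by rewrite (leq_trans (size_poly _ _)) // sizeQ.
    by rewrite sXn // size_polyN (leq_trans (size_poly _ _)) // size_poly.
  move=> j jN; rewrite -(@eqmodX_mull _ N (toR Q) _ _ ht j jN) mulrCA.
  apply/esym; rewrite (@eqmodX_mull _ N (toR h + t *: 'X^n) _ ((P`_0)%:~R *: toR P)) //.
  by move=> i iN; rewrite -rmorphM coef_map rev_quot // coefCM coefZ coef_map /= rmorphM.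
(* At 1 the identity reads P(0) (h(1) + t) = t - h(1), because Q(1) = P(1) is nonzero. P(0) = 1
   would give h(1) = 0. *)
have [eta1 t0] : P`_0 = -1 /\ t = 0.
  have := congr1 (fun p : {poly R} => p.[1]) ht.
  rewrite !hornerM !hornerD hornerN !hornerZ hornerXn expr1n !mulr1.
  have map1 (p : {poly int}) : (toR p).[1] = p.[1]%:~R by rewrite -horner_map /= rmorph1.
  have Q1 : Q.[1] = P.[1] by rewrite horner1_revp // sizeP.
  have := horner1_neq0; rewrite !map1 Q1 horner1_revp //.
  set p1 : R := (P.[1])%:~R => p1_neq0 /eqP.
  rewrite mulrA [_ * p1]mulrC (inj_eq (mulfI p1_neq0)) => /eqP E.
  have H0 : (h.[1])%:~R != 0 :> R by rewrite intr_eq0.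
  have := constant_unit; move: (P`_0) E => e E /eqP; rewrite sqrf_eq1.
  move=> /orP[] /eqP e1; move: E; rewrite e1 ?mulr1 ?mulrN1 => E; last by split=> //; lra.
  by move: H0; rewrite (_ : _%:~R = 0) ?eqxx //; lra.
have PhQ : P * h = Q * revp n h.
  apply: (map_inj_poly (intr_inj : injective (intr : int -> R))); first exact: rmorph0.
  move: ht; rewrite eta1 t0 !scale0r !addr0 !rmorphM /= => ht.
  by rewrite mulrC -[LHS]opprK -[RHS]opprK -mulrN -[X in _ = - X]mulrN -ht mulrN1z scaleN1r.
have monic_r : revp n h \is monic.
  have rn : (revp n h)`_n = 1 by rewrite coef_poly ltnSn subnn.
  have sr : size (revp n h) = n.+1.
    apply/eqP; rewrite eqn_leq size_poly /= ltnNge; apply/negP => /(nth_default 0).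
    by rewrite rn => /eqP; rewrite oner_eq0.
  by rewrite monicE lead_coefE sr rn.
have dvd_r : toQ P %| toQ (revp n h).
  have : toQ P %| toQ Q * toQ (revp n h) by rewrite -rmorphM -PhQ rmorphM dvdp_mulr.
  rewrite Gauss_dvdpr //.
  have [//|] := coprime_or_root Q.
  rewrite /root map_revp horner_revp ?alpha_neq0 ?size_PR // mulf_eq0 expf_eq0.
  by rewrite (negPf alpha_neq0) andbF; move: inv_alpha_neq_root; rewrite /root => /negPf ->.
have [C def_r] := dvdpP _ _ dvd_r.
have def_h : toQ h = toQ Q * C.
  apply: (mulfI (_ : toQ P != 0)); first by rewrite irredp_neq0.
  by rewrite -rmorphM PhQ rmorphM /= def_r; ring.
have C1 : C %= 1.
  have /coprimepP := cop; apply; first by rewrite def_h dvdp_mull.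
  by rewrite def_r dvdp_mulr.
apply: (map_inj_poly (intr_inj : injective (intr : int -> rat))); first exact: rmorph0.
have monicC : C \is monic.
  by rewrite -(monicMr _ (monic_map intr P_monic)) -def_r monic_map.
by rewrite def_r; move: C1; rewrite eqp_monic ?monic1 // => /eqP ->; rewrite mul1r.
Qed.

(** * The extremal polynomials *)

Section Families.
Variable N : nat.
Hypothesis N_large : (d.*2 + 20 <= N)%N.
Local Notation U := (quot_series N).
Local Notation B := (fibden int).

(** D and B have constant term 1, so the congruence D h V = - D r B modulo X^(n+1) can be divided by
    D B, which leaves h U = - r. D serves to clear the denominator of a geometric sum, and W
    witnesses the congruence. *)
Lemma family_reversed n (h r V D W : {poly int}) : (n <= d.+4)%N ->
  h = revp n r -> r = revp n h -> h`_0 = 1 -> h`_n = -1 -> h.[1] != 0 ->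
  eqmodX n.+1 (B * U) V -> D`_0 = 1 ->
  D * h * V = - (D * r * B) + 'X^(n.+1) * W ->
  coprimep (toQ h) (toQ r) -> P = r.
Proof.
move=> nd hr rh h0 hn h1 BU D0 hV cop; rewrite rh.
apply: (@pisot_poly_reversed N n h) => //; rewrite -?rh //.
- by move: N_large nd; lia.
- by rewrite hr size_poly.
apply: (@eqmodX_cancel _ _ (D * B)).
  by rewrite coefM big_ord1 D0 /fibden !coefB coef1 coefX coefXn.
have -> : D * B * - r = - (D * r * B) by ring.
apply: eqmodX_trans (eqmodX_add_mulXn hV).
have -> : D * B * (h * U) = D * h * (B * U) by ring.
by apply: eqmodX_mull.
Qed.

Lemma family_fibonacci k : (k.+3 <= d.+4)%N ->
  eqmodX k.+4 (B * U) (1 - 'X^2 - 'X^(k.+3)) ->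
  P = 'X^(k.+1) * ('X^2 - 'X - 1) + 'X^2 - 1.
Proof.
move=> kd BU; pose h : {poly int} := 1 - 'X - 'X^2 + 'X^(k.+1) - 'X^(k.+3).
pose r : {poly int} := 'X^(k.+3) - 'X^(k.+2) - 'X^(k.+1) + 'X^2 - 1.
have -> : 'X^(k.+1) * ('X^2 - 'X - 1) + 'X^2 - 1 = r by rewrite /r !exprS; ring.
have e1 : h = revp k.+3 r.
  rewrite /r !(revpD, revpN) revp1 (revpXn _ (addn0 _)) (revpXn _ (addn1 _)).
  by rewrite (revpXn _ (addn2 _)) (@revpXn _ _ 2 k.+1) // expr0 expr1 /h; ring.
have e2 : r = revp k.+3 h.
  rewrite /h !(revpD, revpN) revp1 revpX (@revpXn _ _ 2 k.+1) //.
  by rewrite (revpXn _ (addn2 _)) (revpXn _ (addn0 _)) expr0 /r; ring.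
have hE x : h.[x] = 1 - x - x ^+ 2 + x ^+ k.+1 - x ^+ k.+3.
  by rewrite /h !hornerE.
have h0 : h`_0 = 1 by rewrite -horner_coef0 hE !expr0n; lia.
apply: (family_reversed (D := 1) (W := 1 + 'X - 'X^k * (1 - 'X^2)) kd e1 e2) BU _ _ _.
- exact: h0.
- by rewrite /h !coefD !coefN !coef1 coefX !coefXn; lia.
- by rewrite hE !expr1n.
- by rewrite coef1.
- by rewrite /h /r /fibden !exprS; ring.
(* A common divisor of h and r divides X^2, whereas h(0) = 1. *)
apply: (@bezout_coprime _ _ _ 'X^2 ('X^2 - 'X - 1) ('X^2 - 1)).
  have : ('X^2 - 'X - 1) * h + ('X^2 - 1) * r = 'X^2 :> {poly int}.
    by rewrite /h /r !exprS; ring.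
  move/(congr1 toQ); rewrite rmorphD !rmorphM !rmorphB !rmorph1 /= map_polyX.
  by rewrite map_polyXn.
rewrite coprimep_expr // -['X]subr0 coprimep_XsubC /root horner_coef0 coef_map.
by rewrite /= h0 oner_eq0.
Qed.

(** Here (1 - X) h = 1 - X - X^2 + X^(m+2). Common divisors of h and r divide (X - 1)(X + 1)^2; h(1)
    = 1 - m, and h(-1) = 1 because m is even. *)
Lemma family_even m : (m <= d.+3)%N -> ~~ odd m -> (1 < m)%N ->
  eqmodX m.+2 (B * U) (1 - 'X^m - 'X^(m.+1)) -> P.[1] = 1 - m%:R.
Proof.
move=> md em m1 BU; pose S : {poly int} := \poly_(i < m) 1.
pose h := 1 - 'X^2 * S; pose r := 'X^(m.+1) - S.
have S1X : (1 - 'X) * S = 1 - 'X^m.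
  rewrite -[RHS]opprB subrX1 -mulNr opprB /S poly_def.
  by congr (_ * _); apply: eq_bigr => i _; rewrite scale1r.
have hC i : h`_i = (i == 0)%N%:R - (1 < i < m.+2)%N%:R.
  rewrite coefB coef1 coefXnM coef_poly; congr (_ - _).
  case: ltnP => i2; first by [].
  by rewrite (_ : (i - 2 < m)%N = (i < m.+2)%N); [case: ifP | lia].
have rC i : r`_i = (i == m.+1)%N%:R - (i < m)%N%:R.
  by rewrite coefB coefXn coef_poly; congr (_ - _); case: ifP.
have e1 : h = revp m.+1 r.
  apply/polyP => i; rewrite coef_poly hC rC; case: (ltnP i m.+2) => im.
    have -> : (m.+1 - i == m.+1)%N = (i == 0)%N by clear -im; lia.
    have -> : (m.+1 - i < m)%N = (1 < i)%N by clear -im; lia.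
    by rewrite andbT.
  have -> : (i == 0)%N = false by clear -im; lia.
  by rewrite andbF subr0.
have e2 : r = revp m.+1 h.
  apply/polyP => i; rewrite coef_poly hC rC; case: (ltnP i m.+2) => im.
    have -> : (m.+1 - i == 0)%N = (i == m.+1)%N by clear -im; lia.
    by have -> : (1 < m.+1 - i < m.+2)%N = (i < m)%N by clear -im; lia.
  have -> : (i == m.+1)%N = false by clear -im; lia.
  have -> : (i < m)%N = false by clear -im; lia.
  by rewrite subr0.
have hE x : h.[x] = 1 - x ^+ 2 * S.[x] by rewrite /h !hornerE.
have Sm1 : S.[-1] = 0.
  have := congr1 (fun p : {poly int} => p.[-1]) S1X.
  by rewrite hornerM !hornerE -signr_odd (negPf em) subrr => /eqP; rewrite mulf_eq0 => /eqP.
have S1 : S.[1] = m%:R.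
  rewrite horner_poly (eq_bigr (fun=> 1)) ?sumr_const ?card_ord //.
  by move=> i _; rewrite expr1n mulr1.
have h0 : h`_0 = 1 by rewrite -horner_coef0 hE expr0n mul0r subr0.
have -> : P = r; last first.
  by rewrite /r !hornerE expr1n S1.
have mul_h : (1 - 'X) * h = B + 'X^(m.+2).
  by rewrite /h mulrBr mulr1 mulrCA S1X /fibden !exprS; ring.
have mul_r : (1 - 'X) * r = - 1 - 'X^m * ('X^2 - 'X - 1).
  by rewrite /r mulrBr S1X !exprS; ring.
apply: (family_reversed (D := 1 - 'X) (W := 'X + 'X^2 - 'X^m - 'X^(m.+1)) _ e1 e2) BU _ _ _ => //.
- by rewrite hC ltnSn ltnS (ltnW m1).
- by rewrite hE expr1n S1; lia.
- by rewrite coefB coef1 coefX.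
- by rewrite mul_h mul_r /fibden !exprS; ring.
apply: (@bezout_coprime _ _ _ (('X - 1) * ('X + 1) ^+ 2) ('X^2 - 'X - 1) 'X^2).
  have : ('X^2 - 'X - 1) * h + 'X^2 * r = ('X - 1) * ('X + 1) ^+ 2 :> {poly int}.
    apply: (mulfI (_ : 1 - 'X != 0 :> {poly int})).
      by rewrite -size_poly_eq0 -opprB size_polyN size_XsubC.
    by rewrite mulrDr mulrCA mul_h mulrCA mul_r /fibden !exprS; ring.
  move/(congr1 toQ).
  by rewrite !(rmorphD, rmorphN, rmorphM, rmorphXn, rmorph1) /= !map_polyX.
rewrite coprimepMr coprimep_pexpr // coprimep_Xsub1 coprimep_Xadd1.
by rewrite !hE S1 Sm1; clear -m1; lia.
Qed.

(** Here (1 - X^2) h = 1 - X - X^2 + X^(2M+3). Common divisors of h and r divide X^2 - 1, while h(1)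
    = -M and h(-1) = M + 2. *)
Lemma family_odd M : (0 < M)%N -> (M.*2.+1 <= d.+4)%N ->
  eqmodX M.*2.+2 (B * U) (1 - 'X^(M.*2.+1)) -> P.[-1] = - (M%:R + 2).
Proof.
move=> M0 Md BU; pose S : {poly int} := \sum_(i < M.+1) 'X^(i.*2).
pose h := 1 - 'X * S; pose r := 'X^(M.*2.+1) - S.
have SX : (1 - 'X^2) * S = 1 - 'X^(M.*2.+2).
  rewrite -doubleS -mul2n exprM -[RHS]opprB subrX1 -[RHS]mulNr [in RHS]opprB.
  by congr (_ * _); apply: eq_bigr => i _; rewrite -mul2n exprM.
have XS : 'X * S = \sum_(i < M.+1) 'X^(i.*2.+1).
  by rewrite mulr_sumr; apply: eq_bigr => i _; rewrite exprS.
have e1 : h = revp M.*2.+1 r.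
  rewrite /h XS /r /S revpD revpN (revpXn _ (addn0 _)) expr0.
  rewrite (@revp_sum _ _ _ (fun i => 'X^(i.*2))).
  congr (_ - _); rewrite (reindex_inj rev_ord_inj) /=; apply: eq_bigr => i _.
  by symmetry; apply: revpXn; have := ltn_ord i; lia.
have e2 : r = revp M.*2.+1 h.
  rewrite /h revpD revpN revp1 XS (@revp_sum _ _ _ (fun i => 'X^(i.*2.+1))).
  congr (_ - _); rewrite /S (reindex_inj rev_ord_inj) /=; apply: eq_bigr => i _.
  by symmetry; apply: revpXn; have := ltn_ord i; lia.
have hE x : h.[x] = 1 - x * S.[x] by rewrite /h !hornerE.
have S1 e : e ^+ 2 = 1 -> S.[e] = M.+1%:R.
  move=> e2'; rewrite horner_sum (eq_bigr (fun=> 1)) ?sumr_const ?card_ord //.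
  by move=> i _; rewrite hornerXn -mul2n exprM e2' expr1n.
have h0 : h`_0 = 1 by rewrite -horner_coef0 hE mul0r subr0.
have -> : P = r; last first.
  rewrite /r hornerD hornerN hornerXn S1 ?sqrrN ?expr1n // -signr_odd /= odd_double expr1.
  by clear; lia.
have mul_h : (1 - 'X^2) * h = B + 'X^(M.*2.+3).
  by rewrite /h mulrBr mulr1 mulrCA SX /fibden !exprS; ring.
have mul_r : (1 - 'X^2) * r = - 1 - 'X^(M.*2.+1) * ('X^2 - 'X - 1).
  by rewrite /r mulrBr SX !exprS; ring.
apply: (family_reversed (D := 1 - 'X^2) (W := 1 - 'X + 'X^3 - 'X^(M.*2.+2)) _ e1 e2) BU _ _ _ => //.
- rewrite e1 coef_poly ltnSn subnn -horner_coef0 /r hornerD hornerN hornerXn expr0n sub0r.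
  congr (- _); rewrite horner_sum big_ord_recl hornerXn expr0 big1 ?addr0 // => i _.
  by rewrite hornerXn expr0n.
- by rewrite hE mul1r S1 ?expr1n //; clear -M0; lia.
- by rewrite coefB coef1 coefXn.
- by rewrite mul_h mul_r /fibden !exprS; ring.
apply: (@bezout_coprime _ _ _ (('X - 1) * ('X + 1)) ('X^2 - 'X - 1) 'X^2).
  have : ('X^2 - 'X - 1) * h + 'X^2 * r = ('X - 1) * ('X + 1) :> {poly int}.
    apply: (mulfI (_ : 1 - 'X^2 != 0 :> {poly int})).
      by rewrite -size_poly_eq0 -opprB size_polyN size_XnsubC.
    by rewrite mulrDr mulrCA mul_h mulrCA mul_r /fibden !exprS; ring.
  move/(congr1 toQ).
  by rewrite !(rmorphD, rmorphN, rmorphM, rmorphXn, rmorph1) /= !map_polyX.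
rewrite coprimepMr coprimep_Xsub1 coprimep_Xadd1.
by rewrite !hE !S1 ?sqrrN ?expr1n //; clear -M0; lia.
Qed.

Lemma family_exceptional : eqmodX 7 (B * U) (1 - 'X^4) -> (6 <= d.+4)%N ->
  P = 'X^6 - 2 * 'X^5 + 'X^4 - 'X^2 + 'X - 1.
Proof.
move=> BU d2; pose h : {poly int} := 1 - 2%:P * 'X + 'X^2 - 'X^4 + 'X^5 - 'X^6.
pose r : {poly int} := 'X^6 - 2%:P * 'X^5 + 'X^4 - 'X^2 + 'X - 1.
have -> : 'X^6 - 2 * 'X^5 + 'X^4 - 'X^2 + 'X - 1 = r by rewrite /r polyCD polyC1; ring.
have e1 : h = revp 6 r.
  rewrite /r !(revpD, revpN) revp1 revpX revpZ (@revpXn _ 6 6 0) // (@revpXn _ 6 5 1) //.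
  by rewrite (@revpXn _ 6 4 2) // (@revpXn _ 6 2 4) // expr0 expr1 /h; ring.
have e2 : r = revp 6 h.
  rewrite /h !(revpD, revpN) revp1 revpZ revpX (@revpXn _ 6 6 0) // (@revpXn _ 6 5 1) //.
  by rewrite (@revpXn _ 6 4 2) // (@revpXn _ 6 2 4) // expr0 expr1 /r; ring.
have hE x : h.[x] = 1 - 2 * x + x ^+ 2 - x ^+ 4 + x ^+ 5 - x ^+ 6 by rewrite /h !hornerE.
apply: (family_reversed (D := 1) (W := 1 - 'X^2 + 'X^3) _ e1 e2) BU _ _ _ => //.
- by rewrite -horner_coef0 hE.
- by rewrite e1 coef_poly /= subnn -horner_coef0 /r !hornerE.
- by rewrite hE.
- by rewrite coef1.
- by rewrite /h /r /fibden polyCD polyC1; ring.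
(* Bezout cofactors with integer coefficients, for which the combination is exactly 1. *)
apply: (@bezout_coprime _ _ _ 1 (toQ (-1 + 3 * 'X + 'X^2 + 'X^3 + 3 * 'X^4 - 3 * 'X^5))
  (toQ (-2 + 3 * 'X - 'X^2 - 2 * 'X^3 - 3 * 'X^5))); last exact: coprimep1.
rewrite -!rmorphM -rmorphD /h /r polyCD polyC1.
by rewrite -[RHS](rmorph1 toQ); congr (toQ _); ring.
Qed.

End Families.

(** * Classification of the minimal polynomials *)

Section Classification.
Local Notation N := (d.*2 + 20)%N.
Local Notation U := (quot_series N).
Local Notation V := (fibden int * U).

Let UR0 : (toR U)`_0 = 1.
Proof. by rewrite coef_map quot_coef0 //; lia. Qed.

Let energyU n (h : {poly R}) : (n < N)%N ->
  energy n.+1 (h * toR U) <=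
  energy n.+1 h + (alpha ^+ 2 - 1) * tailval alpha n h ^+ 2.
Proof. by move=> nN; apply: energy_int constant_unit nN. Qed.

Lemma map_fibden : toR (fibden int) = fibden R.
Proof. by rewrite /fibden !rmorphB rmorph1 /= map_polyX map_polyXn. Qed.

Lemma map_pattern n (A : {poly int}) :
  eqmodX n V A -> eqmodX n (fibden R * toR U) (toR A).
Proof. by move=> VA j jn; rewrite -map_fibden -rmorphM !coef_map VA. Qed.

Lemma map_add_monomial (A : {poly int}) c n :
  toR (A + c%:P * 'X^n) = toR A + (c%:~R)%:P * 'X^n.
Proof. by rewrite rmorphD [X in _ + X]rmorphM /= map_polyC map_polyXn. Qed.

Lemma map_1subXn n : toR (1 - 'X^n) = 1 - 'X^n.
Proof. by rewrite rmorphB rmorph1 /= map_polyXn. Qed.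

(** Both sides have degree at most d + 2, so agreement modulo X^(d+3) is equality. *)
Lemma pattern_full (A : {poly int}) : (size A <= 3)%N ->
  eqmodX d.+3 V A -> Q * A = (P`_0)%:P * P * fibden int.
Proof.
move=> sA VA; have sB : (size (fibden int) <= 3)%N.
  rewrite /fibden (leq_trans (size_polyD _ _)) // geq_max size_polyN size_polyXn andbT.
  by rewrite (leq_trans (size_polyD _ _)) // geq_max size_polyN size_polyX size_poly1.
apply: (@eqmodX_eq _ d.+3).
- by apply: (size_polyM_le sizeQ sA); clear; lia.
- rewrite mulrC mul_polyC -scalerAr (leq_trans (size_scale_leq _ _)) //.
  by apply: (@size_polyM_le _ 3 d.+1 d.+3 _ _ sB); [rewrite sizeP | clear; lia].
apply: eqmodX_trans (eqmodX_sym (eqmodX_mull Q VA)) _.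
have -> : Q * V = Q * U * fibden int by ring.
apply: eqmodX_mulr; apply: (eqmodX_le _ (@rev_quot N)); clear; lia.
Qed.

Lemma deviation (A : {poly int}) : (size A <= 3)%N ->
  Q * A <> (P`_0)%:P * P * fibden int ->
  exists m, [/\ (m < d.+3)%N, V`_m != A`_m & eqmodX m V A].
Proof.
move=> sA QA; have exm : exists m, (m < d.+3)%N && (V`_m != A`_m).
  have [/existsP[i Vi]|/existsPn VA] := boolP [exists i : 'I_d.+3, V`_i != A`_i].
    by exists i; rewrite ltn_ord.
  case: QA; apply: pattern_full => // j jn.
  by have := VA (Ordinal jn); rewrite negbK => /eqP.
case: (ex_minnP exm) => m /andP[md Vm] min_m; exists m; split=> // j jm.
apply/eqP/negbNE/negP => Vj; have := min_m j; rewrite Vj (ltn_trans jm md).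
by move=> /(_ isT); rewrite leqNgt jm.
Qed.

Lemma int_minus1 (c : int) : c != 0 -> -2 < c%:~R :> R -> c%:~R < 1 :> R -> c = -1.
Proof.
rewrite -[-2]/((-2)%:~R) -[1]/(1%:~R) !ltr_int => c0 c2 c1.
by move: c c0 c2 c1; lia.
Qed.

Lemma coefU1 : U`_1 = V`_1 + 1.
Proof.
by rewrite /fibden !mulrBl mul1r !coefB coefXM coefXnM /= quot_coef0 ?subr0 ?subrK //; lia.
Qed.

(** Otherwise h = 1 - alpha X, whose tail value is 0, would be its own image without loss of energy.
    Then U = 1 modulo X^N and Q = P(0) P, so Q would vanish at alpha, that is, P at 1/alpha. *)
Lemma coefU1_neq0 : U`_1 != 0.
Proof.
apply/negP => /eqP U1; pose h : {poly R} := 1 - alpha%:P * 'X.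
have h0 : h`_0 = 1 by rewrite coefB coef1 coefCM coefX mulr0 subr0.
have h1 : h`_1 = - alpha by rewrite coefB coef1 coefCM coefX mulr1 sub0r.
have sh : (size h <= 2)%N.
  rewrite (leq_trans (size_polyD _ _)) // geq_max size_poly1 size_polyN mul_polyC.
  by rewrite (leq_trans (size_scale_leq _ _)) // size_polyX.
have hU : eqmodX 2 (h * toR U) h.
  move=> [|[|j]] // _.
    by rewrite coefM big_ord1 h0 UR0 mulr1.
  rewrite coefM !big_ord_recl big_ord0 /= h0 h1 UR0 coef_map /= U1.
  by rewrite mulr0 add0r mulr1 addr0.
have := @energy_null _ alpha N (toR U) energyU 1 h h _ sh sh _ hU erefl.
rewrite tailvalS tailval0 h0 h1 mulr1 subrr => /(_ _ erefl)/wrap[]; first by lia.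
move=> hUN; have UN1 : eqmodX N (toR U) 1.
  by apply: (@eqmodX_cancel _ _ h) => //; rewrite mulr1.
have QP : Q = (P`_0)%:P * P.
  apply: (@eqmodX_eq _ N).
  - by rewrite (leq_trans sizeQ) //; lia.
  - by rewrite mul_polyC (leq_trans (size_scale_leq _ _)) // sizeP; lia.
  have UZ : eqmodX N U 1.
    move=> j jN; apply: (intr_inj : injective (intr : int -> R)).
    by have := UN1 j jN; rewrite coef_map /= !coef1 => ->; case: eqP.
  rewrite -[X in eqmodX _ X _]mulr1.
  apply: eqmodX_trans (eqmodX_mull Q (eqmodX_sym UZ)) _.
  exact: (@rev_quot N).
have : (toR Q).[alpha] = 0.
  by rewrite QP rmorphM hornerM (eqP rootP) mulr0.
rewrite map_revp horner_revp ?alpha_neq0 ?size_PR // => /eqP.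
rewrite mulf_eq0 expf_eq0 (negPf alpha_neq0) andbF.
by move: inv_alpha_neq_root; rewrite /root => /negPf ->.
Qed.

Theorem pisot_below_golden :
  [\/ exists k, P = 'X^(k.+1) * ('X^2 - 'X - 1) + 'X^2 - 1,
      exists2 m, (0 < m)%N & P.[-1] = - (m%:R + 2),
      exists2 m, (3 < m)%N & P.[1] = 1 - m%:R |
      P = 'X^6 - 2 * 'X^5 + 'X^4 - 'X^2 + 'X - 1].
Proof.
(* The coefficient of X^(d+2) in P(0) P B is -P(0), which is nonzero, whereas Q has degree at most
   d. Hence B U deviates from 1 before X^(d+3). *)
have cBP k : size P = k.+1 -> ((P`_0)%:P * P * fibden int)`_k.+2 = - P`_0.
  move=> sP; have Pk : P`_k = 1 by have := monicP P_monic; rewrite lead_coefE sP.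
  rewrite -mulrA coefCM [P * _]mulrC /fibden !mulrBl mul1r !coefB coefXM coefXnM /=.
  have P1 : P`_k.+1 = 0 by rewrite nth_default ?sP.
  have P2 : P`_k.+2 = 0 by rewrite nth_default ?sP.
  by rewrite !subSS subn0 Pk P1 P2 subr0 sub0r mulrN1.
have [m [md Vm VA]] : exists m, [/\ (m < d.+3)%N, V`_m != (1 : {poly int})`_m & eqmodX m V 1].
  apply: deviation => [|QB]; first by rewrite size_poly1.
  have := congr1 (fun p : {poly int} => p`_(d.+2)) QB.
  rewrite (cBP _ sizeP) mulr1 nth_default; last by rewrite (leq_trans sizeQ).
  move/eqP.
  by rewrite eq_sym oppr_eq0 (negPf constant_neq0).
have V0 : V`_0 = 1.
  by rewrite /fibden coefM big_ord1 !coefB coef1 coefX coefXn quot_coef0 //; lia.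
have m0 : (0 < m)%N by case: m Vm {md VA} => //; rewrite V0 coef1 eqxx.
have N20 : (d.+3 < N)%N by clear; lia.
pose c := V`_m.
have Vc : eqmodX m.+1 V (1 + c%:P * 'X^m).
  move=> j; rewrite ltnS leq_eqVlt => /orP[/eqP ->|jm].
    by rewrite coefD coefCM coefXn eqxx mulr1 coef1 gtn_eqF // add0r.
  by rewrite VA // coefD coefCM coefXn ltn_eqF // mulr0 addr0.
have c0 : c != 0 by move: Vm; rewrite coef1 gtn_eqF.
have VcR : eqmodX m.+1 (fibden R * toR U) (1 + (c%:~R)%:P * 'X^m).
  have -> : 1 + (c%:~R)%:P * 'X^m = toR (1 + c%:P * 'X^m) :> {poly R}.
    by rewrite map_add_monomial rmorph1.
  exact: map_pattern.
have c1 : c = -1.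
  have [m1|m1] := leqP m 1.
    have em : m = 1%N by apply/eqP; rewrite eqn_leq m1.
    rewrite em in VcR.
    have N1 : (1 < N)%N by clear; lia.
    have cb := linear_coef_bounds alpha_gt1 alpha_lt UR0 energyU N1 VcR.
    by move: cb => /andP[cl cr]; apply: int_minus1.
  have mN : (1 < m < N)%N by rewrite m1 (ltn_trans md).
  apply: int_minus1 => //.
    exact: (first_coef_gt alpha_gt1 alpha_lt UR0 energyU mN VcR).
  exact: (first_coef_lt alpha_gt1 alpha_lt UR0 energyU mN VcR).
(* For m = 1 the value c = -1 would mean that U has no linear term. *)
have m2 : (1 < m)%N.
  rewrite ltn_neqAle m0 andbT; apply/eqP => em; have := coefU1_neq0.
  by move: c1; rewrite coefU1 /c -em => ->; rewrite addNr eqxx.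
clearbody c; rewrite {}c1 in Vc VcR; clear c c0.
have [m3|m3] := leqP m 2.
  have em : m = 2 by apply/eqP; rewrite eqn_leq m3.
  have VA2 : eqmodX 3 V (1 - 'X^2).
    by move=> j j3; rewrite em in Vc; rewrite Vc // polyCN mulN1r.
  (* For m = 2 the comparison restarts with 1 - X^2. Full agreement is impossible, since 1 - X^2
     vanishes at 1 while P(0), P(1) and B(1) do not. *)
  have [k' [kd Vk VA']] : exists m, [/\ (m < d.+3)%N, V`_m != (1 - 'X^2 : {poly int})`_m &
      eqmodX m V (1 - 'X^2)].
    apply: deviation => [|QB].
      by rewrite (leq_trans (size_polyD _ _)) // geq_max size_poly1 size_polyN size_polyXn.
    have := congr1 (fun p : {poly int} => p.[1]) QB.
    have A1 : (1 - 'X^2 : {poly int}).[1] = 0 by rewrite !hornerE.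
    have B1 : (fibden int).[1] = -1 by rewrite /fibden !hornerE.
    rewrite !hornerM A1 B1 hornerC mulr0 => /esym/eqP.
    rewrite !mulf_eq0 (negPf constant_neq0) /= => /orP[P10|//].
    by have := @horner_int_neq0 1 (lexx _); rewrite P10 lt_eqF // => /(_ isT).
  have [k ek] : exists k, k' = k.+3.
    by case: k' Vk {kd VA'} => [|[|[|k]]]; [rewrite VA2 // eqxx..| by exists k].
  rewrite {k'}ek in kd Vk VA'.
  pose c := V`_k.+3.
  have Vc' : eqmodX k.+4 V (1 - 'X^2 + c%:P * 'X^(k.+3)).
    move=> j; rewrite ltnS leq_eqVlt => /orP[/eqP ->|jk].
      by rewrite coefD coefCM coefXn eqxx mulr1 coefB coef1 coefXn /= subr0 add0r.
    by rewrite VA' // [RHS]coefD coefCM coefXn ltn_eqF // mulr0 addr0.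
  have c0 : c != 0 by move: Vk; rewrite coefB coef1 coefXn subr0.
  have VcR' : eqmodX k.+4 (fibden R * toR U) (1 - 'X^2 + (c%:~R)%:P * 'X^(k.+3)).
    have -> : 1 - 'X^2 + (c%:~R)%:P * 'X^(k.+3) =
        toR (1 - 'X^2 + c%:P * 'X^(k.+3)) :> {poly R}.
      by rewrite map_add_monomial map_1subXn.
    exact: map_pattern.
  have kN : (k.+3 < N)%N := ltn_trans kd N20.
  have c1 : c = -1.
    apply: int_minus1 => //.
      apply: lt_le_trans (shift_coef_ge alpha_gt1 alpha_lt UR0 energyU kN VcR').
      by rewrite ltrN2 ltr1n.
    exact: (shift_coef_lt alpha_gt1 alpha_lt UR0 energyU kN VcR').
  constructor 1; exists k; apply: (@family_fibonacci N) => //.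
    by move: kd; clear; lia.
  by move=> j jk; rewrite Vc' // c1 polyCN mulN1r.
have [om|em] := boolP (odd m).
  have [M eM] : exists M, m = M.*2.+1.
    by exists m./2; rewrite -[LHS]odd_double_half om.
  rewrite {m}eM in m0 m2 m3 md om Vc VcR {Vm VA}.
  constructor 2; exists M; first by move: m3; clear; lia.
  apply: (@family_odd N) => //; first by move: m3; clear; lia.
    by move: md; clear; lia.
  by move=> j jm; rewrite Vc // polyCN mulN1r.
have m4 : (3 < m)%N by move: m3 em; clear; case: m => [|[|[|[|m]]]].
have {}Vc : eqmodX m.+1 V (1 - 'X^m) by move=> j jm; rewrite Vc // polyCN mulN1r.
(* For even m >= 4 the next coefficient is -1 or 0; the value 0 survives only for m = 4. *)
pose e := V`_m.+1.
have Ve : eqmodX m.+2 V (1 - 'X^m + e%:P * 'X^(m.+1)).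
  move=> j; rewrite ltnS leq_eqVlt => /orP[/eqP ->|jm].
    by rewrite coefD coefCM coefXn eqxx mulr1 coefB coef1 coefXn (gtn_eqF (ltnSn m)) subr0 add0r.
  by rewrite Vc // [RHS]coefD coefCM coefXn ltn_eqF // mulr0 addr0.
have VeR : eqmodX m.+2 (fibden R * toR U) (1 - 'X^m + (e%:~R)%:P * 'X^(m.+1)).
  by rewrite -map_1subXn -map_add_monomial; exact: map_pattern.
have mN : (m.+1 < N)%N by move: md; clear; lia.
have e_gt := second_coef_gt alpha_gt1 alpha_lt UR0 energyU m2 mN VeR.
have e_lt := second_coef_lt alpha_gt1 alpha_lt UR0 energyU m4 mN VeR.
have [e0|e0] := eqVneq e 0; last first.
  have e1 : e = -1 by exact: int_minus1.
  constructor 3; exists m => //; apply: (@family_even N) => //.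
    by move: md; clear; lia.
  by move=> j jm; rewrite Ve // e1 polyCN mulN1r.
rewrite {e_gt e_lt}e0 in Ve VeR.
have [m5|m5] := leqP m 4.
  have e4 : m = 4 by apply/eqP; rewrite eqn_leq m5.
  rewrite {m}e4 in md mN Ve {m0 m2 m3 m4 m5 em Vm VA Vc VcR VeR e}.
  pose x := V`_6.
  have Vx : eqmodX 7 V (1 - 'X^4 + x%:P * 'X^6).
    move=> j; rewrite ltnS leq_eqVlt => /orP[/eqP ->|j6].
      by rewrite coefD coefCM coefXn eqxx mulr1 coefB coef1 coefXn subr0 add0r.
    by rewrite Ve // mul0r addr0 [RHS]coefD coefCM coefXn ltn_eqF // mulr0 addr0.
  have VxR : eqmodX 7 (fibden R * toR U) (1 - 'X^4 + (x%:~R)%:P * 'X^6).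
    by rewrite -map_1subXn -map_add_monomial; exact: map_pattern.
  have N6 : (6 < N)%N by clear; lia.
  have x0 : x = 0.
    have := exceptional_coef UR0 energyU N6 VxR.
    have -> : x%:~R * (2 - 3 * x%:~R) = (x * (2 - 3 * x))%:~R :> R.
      by rewrite rmorphM rmorphB rmorphM.
    by rewrite ler0z; clearbody x; clear; nia.
  constructor 4; apply: (@family_exceptional N) => //.
  by move=> j jm; rewrite Vx // x0 mul0r addr0.
have [k ek] : exists k, m = k.*2.+4.+2.
  exists (m./2 - 3)%N; have := odd_double_half m; rewrite (negPf em) add0n.
  by move: m5; clear; lia.
rewrite ek in mN VeR.
by case: (second_coef_even_neq0 alpha_gt1 alpha_lt UR0 energyU mN VeR).
Qed.

End Classification.

End Pisot.

(** * Sequences modulo 1 avoiding the integers *)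

(** Divisibility makes c z^k / q satisfy the recurrence of P modulo 1; the residue bounds keep it at
    distance at least 3/17 from the integers. *)
Definition avoids_integers (P : {poly int}) (q z c : int) : Prop :=
  [/\ 0 < q, (q %| P.[z])%Z &
      forall k, 3 * q <= 17 * (c * z ^+ k %% q)%Z <= 14 * q].

Lemma residues_closed (q z c : int) (S : seq int) :
  c \in S -> all (fun r => (r == r %% q)%Z && ((r * z %% q)%Z \in S)) S ->
  forall k, (c * z ^+ k %% q)%Z \in S.
Proof.
move=> cS closedS; elim=> [|k IH].
  by rewrite mulr1; have /allP/(_ _ cS)/andP[/eqP <-] := closedS.
have /allP/(_ _ IH)/andP[_] := closedS.
by rewrite modzMml exprSr mulrA.
Qed.

Lemma avoids_of_residues (P : {poly int}) (q z c : int) (S : seq int) :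
  0 < q -> (q %| P.[z])%Z -> c \in S ->
  all (fun r => (r == r %% q)%Z && ((r * z %% q)%Z \in S)) S ->
  all (fun r => 3 * q <= 17 * r <= 14 * q) S ->
  avoids_integers P q z c.
Proof.
move=> q0 qP cS closedS farS; split=> // k.
exact: (allP farS _ (residues_closed cS closedS k)).
Qed.

(** As z is 1 or -1, the only residues are c = floor(q/2) and q - c, and c / q >= 1/3 for q >= 3. *)
Lemma avoids_unit (P : {poly int}) (z : int) :
  (z == 1) || (z == -1) -> 3 <= `|P.[z]| -> exists q z c, avoids_integers P q z c.
Proof.
set q := `|P.[z]| => z1 q3; pose c := (q %/ 2)%Z.
have := divz_eq q 2; have := modz_ge0 q (isT : (2 : int) != 0).
have := ltz_pmod q (isT : (0 : int) < 2); rewrite -/c => r2 r0 qE.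
have q0 : 0 < q by lia.
exists q, z, c; apply: (@avoids_of_residues _ _ _ _ [:: c; q - c]) => //=.
- by rewrite dvdzE /q -abszE absz_nat dvdnn.
- by rewrite mem_head.
- have cS : (c %% q)%Z = c by rewrite modz_small //; lia.
  have qcS : ((q - c) %% q)%Z = q - c by rewrite modz_small //; lia.
  have NcS : (- c %% q)%Z = q - c by rewrite -qcS -modzDl addrC.
  have NqcS : ((c - q) %% q)%Z = c by rewrite -modzDr subrK cS.
  case/orP: z1 => /eqP ->; rewrite ?mulr1 ?mulrN1 ?opprB cS qcS ?NcS ?NqcS !inE !eqxx ?orbT //.
- by apply/andP; split; [|rewrite andbT]; lia.
Qed.

Definition fibonacci_family (n : nat) : {poly int} := 'X^n * ('X^2 - 'X - 1) + 'X^2 - 1.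

(** The order of z modulo q divides p, so the value modulo q depends only on n modulo p; a and w
    certify the two congruences. *)
Lemma fibonacci_family_dvd (q z a w : int) p i j n :
  z ^+ p = 1 + q * w -> z ^+ i * (z ^+ 2 - z - 1) + z ^+ 2 - 1 = q * a ->
  (n = p * j + i)%N -> (q %| (fibonacci_family n).[z])%Z.
Proof.
move=> zp zi ->; have [v zpj] : exists v, z ^+ (p * j) = 1 + q * v.
  elim: j => [|j [v IH]]; first by exists 0; rewrite muln0 mulr0 addr0.
  by exists (w + v + q * w * v); rewrite mulnS exprD zp IH; ring.
apply/dvdzP; exists (a + v * z ^+ i * (z ^+ 2 - z - 1)).
rewrite /fibonacci_family !hornerE exprD zpj.
apply/eqP; rewrite -subr_eq0.
rewrite (_ : _ - _ = z ^+ i * (z ^+ 2 - z - 1) + z ^+ 2 - 1 - q * a).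
  by rewrite zi subrr.
by ring.
Qed.

(** Each z has order 4 or 8 modulo q, so n matters only modulo 8, and each list is the orbit of c
    under z. The orbit of 3 modulo 17, used for n = 2 modulo 4, contains 3 and 14 and meets the
    bound 3/17 with equality. *)
Lemma fibonacci_family_avoids n : (0 < n)%N ->
  exists q z c, avoids_integers (fibonacci_family n) q z c.
Proof.
move=> n0; have := divn_eq n 8; have := ltn_pmod n (isT : 0 < 8)%N.
set j := (n %/ 8)%N; case: (n %% 8)%N => [|[|[|[|[|[|[|[|r]]]]]]]] // _ nE.
- exists 17, (-4), 10; apply: (@avoids_of_residues _ _ _ _ [:: 10; 11; 7; 6]) => //.
  by apply: (@fibonacci_family_dvd 17 (-4) 2 15 4 0 (j * 2)) => //; lia.
- exists 5, 2, 1; apply: (@avoids_of_residues _ _ _ _ [:: 1; 2; 4; 3]) => //.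
  by apply: (@fibonacci_family_dvd 5 2 1 3 4 1 (j * 2)) => //; lia.
- exists 17, (-8), 3.
  apply: (@avoids_of_residues _ _ _ _ [:: 3; 10; 5; 11; 14; 7; 12; 6]) => //.
  by apply: (@fibonacci_family_dvd 17 (-8) 271 (241 * 4095) 8 2 j); lia.
- exists 13, (-5), 6; apply: (@avoids_of_residues _ _ _ _ [:: 6; 9; 7; 4]) => //.
  by apply: (@fibonacci_family_dvd 13 (-5) (-277) 48 4 3 (j * 2)) => //; lia.
- exists 17, (-4), 10; apply: (@avoids_of_residues _ _ _ _ [:: 10; 11; 7; 6]) => //.
  by apply: (@fibonacci_family_dvd 17 (-4) 2 15 4 0 (j * 2).+1) => //; lia.
- exists 5, 2, 1; apply: (@avoids_of_residues _ _ _ _ [:: 1; 2; 4; 3]) => //.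
  by apply: (@fibonacci_family_dvd 5 2 1 3 4 1 (j * 2).+1) => //; lia.
- exists 17, (-2), 3.
  apply: (@avoids_of_residues _ _ _ _ [:: 3; 10; 5; 11; 14; 7; 12; 6]) => //.
  by apply: (@fibonacci_family_dvd 17 (-2) 19 15 8 6 j) => //; lia.
- exists 13, (-5), 6; apply: (@avoids_of_residues _ _ _ _ [:: 6; 9; 7; 4]) => //.
  by apply: (@fibonacci_family_dvd 13 (-5) (-277) 48 4 3 (j * 2).+1) => //; lia.
Qed.

Lemma exceptional_avoids : exists q z c,
  avoids_integers ('X^6 - 2 * 'X^5 + 'X^4 - 'X^2 + 'X - 1) q z c.
Proof.
(* 7 has order 3 modulo 19, and the value at 7 is 86393 = 19 * 4547. *)
exists 19, 7, 4; apply: (@avoids_of_residues _ _ _ _ [:: 4; 9; 6]) => //.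
have -> : 2 = 2%:P :> {poly int} by rewrite polyCD polyC1.
apply/dvdzP; exists 4547.
by rewrite !(hornerD, hornerN, hornerM, hornerXn, hornerX, hornerC); lia.
Qed.

(** * Recurrences with all roots inside the unit disc *)

(** Only an upper bound is asked; for the norms to which it is applied in the end, this is
    convergence to 0. *)
Definition vanishing (R : realType) (t : nat -> R) : Prop :=
  forall e, 0 < e -> exists K, forall k, (K <= k)%N -> t k < e.

(** Once b_k < (1 - rho) e / 2, compare with the map x |-> rho x + (1 - rho) e / 2, which contracts
    towards its fixed point e / 2. *)
Lemma vanishing_recurrence (R : realType) (rho : R) (a b : nat -> R) :
  0 <= rho < 1 -> (forall k, a k.+1 <= rho * a k + b k) ->
  vanishing b -> vanishing a.
Proof.
move=> /andP[rho0 rho1] ab b0 e e0.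
have [K bK] := b0 ((1 - rho) * (e / 2)) ltac:(by rewrite mulr_gt0 ?subr_gt0 ?divr_gt0).
have aK j : a (K + j)%N <= rho ^+ j * `|a K| + e / 2.
  elim: j => [|j IH].
    by rewrite addn0 mul1r (le_trans (ler_norm _)) // lerDl divr_ge0 // ltW.
  rewrite addnS (le_trans (ab _)) // exprS -mulrA.
  have := bK (K + j)%N (leq_addr _ _); have := ler_wpM2l rho0 IH.
  by move: (a _) (b _) (rho ^+ j * _) => x y z; lra.
have [J rhoJ] : exists J, forall j, (J <= j)%N -> rho ^+ j * (`|a K| + 1) < e / 2.
  have := @cvg_expr _ rho; rewrite ger0_norm // => /(_ rho1)/cvgrPdist_lt.
  have pos : 0 < e / 2 / (`|a K| + 1) by rewrite !divr_gt0 // ltr_wpDl.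
  move=> /(_ _ pos) [J _ rhoJ]; exists J => j Jj.
  have := rhoJ j Jj; rewrite /= sub0r normrN ger0_norm ?exprn_ge0 //.
  by rewrite ltr_pdivlMr // ltr_wpDl.
exists (K + J)%N => k Kk; rewrite -(subnKC (leq_trans (leq_addr J K) Kk)).
apply: le_lt_trans (aK _) _; have := rhoJ (k - K)%N ltac:(by lia).
have : 0 <= rho ^+ (k - K) by rewrite exprn_ge0.
by rewrite mulrDr mulr1; move: (_ * `|_|) => x; lra.
Qed.

(** The action of p on sequences, with X acting as the shift. *)
Definition shift_act (A : nzRingType) (p : {poly A}) (t : nat -> A) (k : nat) : A :=
  \sum_(i < size p) p`_i * t (k + i)%N.

Lemma shift_act_wide (A : nzRingType) (p : {poly A}) n t k : (size p <= n)%N ->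
  shift_act p t k = \sum_(i < n) p`_i * t (k + i)%N.
Proof.
move=> sp; rewrite /shift_act (big_ord_widen n (fun i => p`_i * t (k + i)%N) sp).
rewrite big_mkcond; apply: eq_bigr => i _; case: ltnP => // pi.
by rewrite nth_default ?mul0r.
Qed.

Lemma shift_act_XsubC (A : comNzRingType) (p : {poly A}) b t k :
  shift_act (('X - b%:P) * p) t k = shift_act p (fun j => t j.+1 - b * t j) k.
Proof.
have sXp : (size (('X - b%:P) * p)%R <= (size p).+1)%N.
  by rewrite (leq_trans (size_polyMleq _ _)) // size_XsubC.
rewrite (shift_act_wide _ _ sXp) /shift_act.
under eq_bigr do rewrite mulrBl coefB coefXM coefCM mulrBl.
rewrite sumrB big_ord_recl /= mul0r add0r big_ord_recr /=.
rewrite [p`_(size p)]nth_default // mulr0 mul0r addr0 -sumrB.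
by apply: eq_bigr => i _; rewrite /bump /= add1n addnS /=; ring.
Qed.

(** Peel off one root b: s_k = t_(k+1) - b t_k tends to 0 by induction, and |t_(k+1)| <= |b| |t_k| +
    |s_k|. *)
Lemma shift_act_vanishing (R : realType) (bs : seq R[i]) (t : nat -> R[i]) :
  (forall b, b \in bs -> `|b| < 1) ->
  (forall k, shift_act (\prod_(b <- bs) ('X - b%:P)) t k = 0) ->
  vanishing (fun k => complex.Re `|t k|).
Proof.
have normE (z : R[i]) : `|z| = (complex.Re `|z|)%:C%C by rewrite normc_def.
elim: bs t => [|b bs IH] t bs1 t0.
  move=> e e0; exists 0%N => k _; have := t0 k.
  rewrite big_nil /shift_act size_poly1 big_ord1 coef1 mul1r addn0 => ->.
  by rewrite normr0.
have {}IH := IH (fun j => t j.+1 - b * t j).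
apply: (@vanishing_recurrence _ (complex.Re `|b|) _
  (fun j => complex.Re `|t j.+1 - b * t j|)).
- have := bs1 b (mem_head _ _); rewrite normE -lecR -(ltcR _ 1) => ->.
  by rewrite -normE normr_ge0.
- move=> k; rewrite -lecR rmorphD rmorphM /= -!normE -normrM addrC.
  by have := ler_normD (t k.+1 - b * t k) (b * t k); rewrite subrK.
apply: IH => [c cbs|k]; first by apply: bs1; rewrite in_cons cbs orbT.
by have := t0 k; rewrite big_cons shift_act_XsubC.
Qed.

Lemma far_from_int (R : realType) (q a m : int) :
  0 < q -> 3 * q <= 17 * (a %% q)%Z <= 14 * q ->
  3 / 17 <= `|a%:~R / q%:~R - m%:~R| :> R.
Proof.
move=> q0 /andP[r3 r14]; have q0R : 0 < q%:~R :> R by rewrite ltr0z.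
have normE : `|a%:~R / q%:~R - m%:~R| * q%:~R = `|a - m * q|%:~R :> R.
  rewrite intr_norm rmorphB rmorphM /= -[X in _ * X](gtr0_norm q0R) -normrM.
  by rewrite mulrBl divfK ?gt_eqF.
rewrite -(ler_pM2r q0R) normE -(ler_pM2l (ltr0n _ 17 : 0 < 17 :> R)).
have -> : 17 * (3 / 17 * q%:~R) = (3 * q)%:~R :> R by rewrite intrM; field.
rewrite -[17 : R]/(17%:~R) -intrM ler_int.
have := divz_eq a q; set r := (a %% q)%Z in r3 r14 *; set b := (a %/ q)%Z => ->.
have [bm|mb] := leP m b.
  have : 0 <= (b - m) * q by apply: mulr_ge0; lia.
  by move: r3; lia.
have : 0 <= (m - b - 1) * q by apply: mulr_ge0; lia.
by move: r14; lia.
Qed.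

(** * From residues to a lower bound for L *)

Section LowerBound.
Variables (R : realType) (alpha : R) (P : {poly int}) (P1 : {poly R}).
Hypotheses (P_monic : P \is monic) (def_P : map_poly intr P = ('X - alpha%:P) * P1).
Hypotheses (alpha_gt1 : 1 < alpha) (P1_monic : P1 \is monic).
Hypothesis rootsP1 : forall w : R[i],
  root (map_poly (real_complex R) P1) w -> `|w| < 1.

Local Notation PR := (map_poly (intr : int -> R) P).

Lemma P1_alpha_neq0 : P1.[alpha] != 0.
Proof.
apply/negP => r; have := @rootsP1 alpha%:C%C; rewrite fmorph_root => /(_ r).
rewrite normc_def /= expr0n addr0 sqrtr_sqr (ltcR _ 1) gtr0_norm ?(lt_trans ltr01) //.
by rewrite ltNge ltW.
Qed.

(** [phi] is a linear form on polynomials modulo P, and [phi 'X^k] is -c z^k / q modulo 1.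
    Subtracting xi times evaluation at alpha gives a form that vanishes on the multiples of [P1], so
    the differences u_k obey the recurrence of [P1] and tend to 0. *)
Lemma approaching (q z c : int) : avoids_integers P q z c ->
  exists xi : R, forall e, 0 < e -> exists K, forall k, (K <= k)%N ->
    forall m : int, 3 / 17 - e <= `|xi * alpha ^+ k - m%:~R|.
Proof.
move=> [q0 qP far]; pose kappa : R := - (c%:~R / q%:~R).
pose phi (f : {poly R}) := kappa * (f %% PR).[z%:~R].
have phiD f g : phi (f + g) = phi f + phi g by rewrite /phi modpD hornerD mulrDr.
have phiZ a f : phi (a *: f) = a * phi f by rewrite /phi modpZl hornerZ mulrCA.
have phiP f : phi (f * PR) = 0 by rewrite /phi modp_mull horner0 mulr0.
(* Modulo X - alpha, f is f(alpha), so [phi (f * P1)] is f(alpha) times [phi P1]; this xi cancels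
   it. *)
pose xi := phi P1 / P1.[alpha].
pose psi f := phi f - xi * f.[alpha].
have psi0 f : psi (f * P1) = 0.
  have [g fE] : exists g, f = g * ('X - alpha%:P) + (f.[alpha])%:P.
    have /factor_theorem[g gE] : root (f - (f.[alpha])%:P) alpha.
      by rewrite /root hornerD hornerN hornerC subrr.
    by exists g; rewrite -gE subrK.
  rewrite /psi hornerM {1}fE mulrDl phiD -mulrA -def_P phiP add0r mul_polyC phiZ.
  by rewrite /xi [_ / _ * (_ * _)]mulrCA divfK ?P1_alpha_neq0 // subrr.
pose u k := psi 'X^k.
have act_u k : shift_act P1 u k = 0.
  rewrite -[RHS](psi0 'X^k) -[in RHS](coefK P1) poly_def mulr_sumr.
  have psi_sum n (F : nat -> {poly R}) : psi (\sum_(i < n) F i) = \sum_(i < n) psi (F i).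
    elim: n => [|n IH]; first by rewrite !big_ord0 /psi /phi mod0p !horner0 !mulr0 subrr.
    by rewrite !big_ord_recr /= -IH /psi phiD hornerD; ring.
  rewrite (psi_sum _ (fun i => 'X^k * (P1`_i *: 'X^i))); apply: eq_bigr => i _.
  rewrite -scalerAr -exprD /u /psi phiZ hornerZ; ring.
have u_vanishing : vanishing (fun k => `|u k|).
  have [bs def_P1] := closed_field_poly_normal (map_poly (real_complex R) P1).
  rewrite lead_coef_map (monicP P1_monic) scale1r in def_P1.
  have := @shift_act_vanishing _ bs (fun k => (u k)%:C%C).
  move=> /(_ _ _)/wrap[].
  - by move=> b bbs; apply: rootsP1; rewrite def_P1 root_prod_XsubC.
  - move=> k; rewrite -def_P1 /shift_act size_map_poly.
    rewrite -[RHS](rmorph0 (real_complex R)) -(act_u k) /shift_act rmorph_sum.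
    by apply: eq_bigr => i _; rewrite coef_map rmorphM.
  - move=> H e /H[K uK]; exists K => k /uK.
    by rewrite normc_def /= expr0n addr0 sqrtr_sqr.
exists xi => e /u_vanishing[K uK]; exists K => k /uK ukK m.
have [A [r [sr Xk]]] : exists A r : {poly int}, (size r < size P)%N /\ 'X^k = A * P + r.
  exists (Pdiv.Ring.rdivp 'X^k P), (Pdiv.Ring.rmodp 'X^k P); split.
    by rewrite Pdiv.Ring.ltn_rmodpN0 // monic_neq0.
  exact: Pdiv.RingMonic.rdivp_eq.
have phiX : phi 'X^k = - ((c * r.[z])%:~R / q%:~R).
  rewrite /phi.
  have -> : 'X^k = map_poly intr A * PR + map_poly intr r :> {poly R}.
    by rewrite -(map_polyXn (intr : int -> R)) Xk rmorphD rmorphM.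
  rewrite modp_addl_mul_small; last by rewrite !size_map_inj_poly ?rmorph0 //; exact: intr_inj.
  by rewrite horner_map /kappa /= rmorphM; ring.
have far_r : 3 * q <= 17 * (c * r.[z] %% q)%Z <= 14 * q.
  have -> : (c * r.[z] %% q)%Z = (c * z ^+ k %% q)%Z.
    have := congr1 (fun p : {poly int} => p.[z]) Xk.
    rewrite hornerXn hornerD hornerM => ->.
    have /dvdzP[b ->] := qP.
    have -> : c * (A.[z] * (b * q) + r.[z]) = c * A.[z] * b * q + c * r.[z] by ring.
    by rewrite modzMDl.
  exact: far.
have := @far_from_int R _ _ (- m) q0 far_r.
have -> : xi * alpha ^+ k = phi 'X^k - u k by rewrite /u /psi hornerXn; ring.
rewrite phiX rmorphN opprK /=.
set y := (c * r.[z])%:~R / q%:~R => le_y.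
have := ler_normD (- y - u k - m%:~R) (u k).
have -> : - y - u k - m%:~R + u k = - (y + m%:~R) by ring.
by rewrite normrN; move: le_y ukK; lra.
Qed.

(** A crude bound, which ensures that [limn_inf] and the supremum in [L] have their genuine
    values. *)
Lemma dist_int_le1 (x : R) : 0 <= dist_int x <= 1.
Proof.
have lb : has_lbound [set `|x - m%:~R| | m in [set: int]].
  by exists 0 => _ [m _ <-].
apply/andP; split.
  apply: lb_le_inf => [|_ [m _ <-] //]; by exists `|x - 0%:~R|; exists 0.
apply: le_trans (ge_inf lb (_ : _ `|x - (Num.floor x)%:~R|)) _; first by exists (Num.floor x).
have /andP[f1 f2] := floor_itv x.
rewrite ler_norml; move: f1 f2; rewrite intrD; lra.
Qed.

Lemma dist_int_ge (x e : R) : (forall m : int, e <= `|x - m%:~R|) -> e <= dist_int x.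
Proof.
move=> xe; apply: lb_le_inf => [|_ [m _ <-] //]; by exists `|x - 0%:~R|; exists 0.
Qed.

Lemma L_ge_avoids (q z c : int) : avoids_integers P q z c -> 3 / 17 <= L alpha.
Proof.
move=> /approaching[xi xiP].
pose v (x : R) n := dist_int (x * alpha ^+ n).
have bv x : bounded_fun (v x).
  exists 1; split => // M M1 n _ /=; have /andP[v0 v1] := dist_int_le1 (x * alpha ^+ n).
  by rewrite ger0_norm // (le_trans v1) // ltW.
have infs_ub x : ubound (range (infs (v x))) 1.
  move=> _ [n _ <-]; have /andP[_] := dist_int_le1 (x * alpha ^+ n).
  apply: le_trans; apply: ge_inf; last by exists n => /=.
  by exists 0 => _ [k _ <-]; have /andP[] := dist_int_le1 (x * alpha ^+ k).
have inf_le1 x : limn_inf (v x) <= 1.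
  rewrite limn_infE //; apply: ge_sup => //; by exists (infs (v x) 0%N); exists 0%N.
apply: (@le_trans _ _ (limn_inf (v xi))); last first.
  apply: ub_le_sup; last by exists xi.
  by exists 1 => _ [x _ <-]; exact: inf_le1.
apply/ler_addgt0Pr => e /xiP[K xiK]; rewrite limn_infE // -lerBlDr.
apply: (@le_trans _ _ (infs (v xi) K)); last first.
  by apply: ub_le_sup; [exists 1; exact: infs_ub | exists K].
apply: lb_le_inf; first by exists (v xi K); exists K => /=.
by move=> _ [k /= Kk <-]; apply: dist_int_ge => m; apply: xiK.
Qed.

End LowerBound.

(** * The integral minimal polynomial and the conclusion *)

(** A nonzero rational polynomial p of least size vanishing at alpha is irreducible and divides the
    monic integer polynomial q. By Gauss's lemma p is proportional to an integer factor P of q,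
    whose leading coefficient divides 1; multiplying by this sign makes P monic. *)
Lemma pisot_min_poly (R : realType) (alpha : R) : pisot alpha ->
  exists P : {poly int}, [/\ P \is monic, irreducible_poly (toQ P),
    root (map_poly (intr : int -> R) P) alpha &
    forall w : R[i], root (map_poly intr P) w -> w != alpha%:C%C -> `|w| < 1].
Proof.
move=> [[q q_monic rootq] _ conj_lt1].
pose kills (p : {poly rat}) := (p != 0) && root (map_poly ratr p) alpha.
have exn : exists n, `[< exists2 p, kills p & size p = n >].
  exists (size (toQ q)); apply/asboolP; exists (toQ q) => //.
  by rewrite /kills monic_neq0 ?monic_map //= map_ratr_int.
case: (ex_minnP exn) => n /asboolP[p /andP[p0 rootp] sp] min_n.
have {}min_n g : kills g -> (size p <= size g)%N.
  by move=> kg; rewrite sp; apply: min_n; apply/asboolP; exists g.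
have size_p : (1 < size p)%N.
  rewrite ltnNge; apply/negP => /size1_polyC pE; move: p0 rootp.
  rewrite pE polyC_eq0 map_polyC rootC /= fmorph_eq0.
  by move=> /negPf ->.
have irr_p : irreducible_poly p.
  split=> // g g1 /dvdpP[f pE].
  have [f0 g0] : f != 0 /\ g != 0.
    by apply/andP; rewrite -negb_or -mulf_eq0 -pE.
  have sfg : size p = (size f + size g).-1 by rewrite pE size_mul.
  move: rootp; rewrite pE rmorphM rootM => /orP[rf|rg].
    have := min_n f; rewrite /kills f0 rf => /(_ isT).
    rewrite sfg -subn1 leq_subLR addnC leq_add2r => g_le1.
    by move: g1; rewrite eqn_leq g_le1 size_poly_gt0 g0.
  rewrite -dvdp_size_eqp ?dvdp_mull // -pE eqn_leq min_n ?/kills ?g0 ?rg // andbT.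
  by rewrite pE dvdp_leq ?mulf_neq0 // dvdp_mull.
have p_dvd_q : p %| toQ q.
  have := min_n (toQ q %% p); rewrite /kills.
  have root_mod : root (map_poly ratr (toQ q %% p)) alpha.
    have := congr1 (fun g : {poly rat} => (map_poly ratr g : {poly R}).[alpha])
      (divp_eq (toQ q) p).
    rewrite rmorphD rmorphM hornerD hornerM (eqP rootp) mulr0 add0r map_ratr_int.
    by rewrite (eqP rootq) /root => <-.
  rewrite root_mod andbT; case: eqP => [|_ /(_ isT)]; first by rewrite /dvdp => ->.
  by rewrite leqNgt ltn_modp p0.
have [P [a a0 pE] [r qE]] := dvdpP_rat_int p_dvd_q.
have lead1 : lead_coef P * lead_coef r = 1.
  by rewrite -lead_coefM -qE (monicP q_monic).
have unit_lead : lead_coef P * lead_coef P = 1.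
  have : lead_coef P \is a GRing.unit by apply/unitrP; exists (lead_coef r); rewrite mulrC lead1.
  by rewrite qualifE /= => /orP[] /eqP ->.
pose P' := lead_coef P *: P.
have l0 : lead_coef P != 0.
  by apply/eqP => l; move: unit_lead; rewrite l mul0r => /eqP; rewrite eq_sym oner_eq0.
have P'E : toQ P' = ((lead_coef P)%:~R / a) *: p.
  by rewrite /P' map_polyZ pE scalerA divfK.
have s0 : (lead_coef P)%:~R / a != 0 by rewrite mulf_neq0 ?invr_eq0 ?intr_eq0.
have rootP' (F : numFieldType) (x : F) :
    root (map_poly intr P') x = root (map_poly ratr p) x.
  by rewrite -map_ratr_int P'E map_polyZ rootZ ?fmorph_eq0.
exists P'; split.
- by rewrite monicE lead_coefZ unit_lead.
- rewrite P'E; have [_ p_irr] := irr_p; split=> [|g g1]; first by rewrite size_scale.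
  by rewrite dvdpZr // => /(p_irr _ g1) /eqp_trans; apply; rewrite eqp_sym eqp_scale.
- by rewrite rootP'.
- move=> w; rewrite rootP' => rw wa; apply: conj_lt1 => //; exists p; split=> //.
  by rewrite -rootP' -map_complex_int fmorph_root rootP'.
Qed.

Theorem theorem5 (R : realType) (alpha : R)
    (alpha_pisot : pisot alpha)
    (alpha_lt : alpha < (Num.sqrt 5 + 1) / 2) :
  3 / 17 <= L alpha.
Proof.
have [P [P_monic irrP rootP conjP]] := pisot_min_poly alpha_pisot.
have [_ alpha_gt1 _] := alpha_pisot.
have alpha_lt' : alpha ^+ 2 < alpha + 1.
  have s5 : Num.sqrt 5 ^+ 2 = 5 :> R by rewrite sqr_sqrtr.
  have s0 : 0 <= Num.sqrt 5 :> R by exact: sqrtr_ge0.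
  by move: s5 s0 alpha_lt; move: (Num.sqrt 5) => s s5 s0 lt_s; nra.
have [P1 [def_P P1_monic _ rootsP1]] := simple_root P_monic irrP rootP conjP.
have [q [z [c]]] : exists q z c, avoids_integers P q z c.
  have [[k ->]|[m m0 Pm]|[m m3 Pm]|->] :=
    pisot_below_golden alpha_gt1 alpha_lt' P_monic irrP rootP conjP.
  - exact: (@fibonacci_family_avoids k.+1).
  - by apply: (@avoids_unit _ (-1)) => //; rewrite Pm; lia.
  - by apply: (@avoids_unit _ 1) => //; rewrite Pm; lia.
  - exact: exceptional_avoids.
move=> avoids; exact: (L_ge_avoids P_monic def_P alpha_gt1 P1_monic rootsP1 avoids).
Qed.
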